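(* Let $\sigma_1,\sigma_2\in L_1[0,1]$ (the case $p=1$), and let $D(x,\mu)$ be the solution of $$D'(x)+J(x)D(x)=A_\mu D(x),\quad x\in[0,1],\qquad D(0)=I.$$ For every $d>0$ there is a constant $c_2=c_2(d,\sigma_1,\sigma_2)$ such that for all $x\in[0,1]$ and $\mu\in P_d$ the remainder $R_0$ in the representation $$D(x,\mu)=e^{xA_\mu}+\int_0^x e^{(x-2t)A_\mu}\big(J(t)+\tilde J(x,t)\big)\,dt+R_0(x,\mu)$$ satisfies $$\|R_0(x,\mu)\|_{M(\mathbb{C})}\le c_2\,\Gamma^2(\mu).$$
   Context: $J_0=\begin{pmatrix}1&0\\0&-1\end{pmatrix}$, $J(x)=\begin{pmatrix}0&\sigma_1(x)\\ \sigma_2(x)&0\end{pmatrix}$ with $\sigma_j$ complex-valued, $I$ the $2\times2$ identity, $A_\mu=i\mu J_0$, $\mu\in\mathbb{C}$. A solution has absolutely continuous entries on $[0,1]$ and satisfies the equation a.e. $P_d:=\{\mu\in\mathbb{C}:|\mathrm{Im}\,\mu|\le d\}$. $\|\cdot\|_{M(\mathbb{C})}$ is the sum of the absolute values of the entries of a $2\times2$ matrix. For $0\le t\le x\le 1$, $\tilde J(x,t)=\int_0^{x-t}J(t+\xi)J(\xi)\,d\xi$. Finally $$\Gamma(\mu)=\sum_{j=1}^2\Big(\sup_{x\in[0,1]}\Big|\int_0^x e^{-2i\mu t}\sigma_j(t)dt\Big|+\sup_{x\in[0,1]}\Big|\int_0^x e^{2i\mu t}\sigma_j(t)dt\Bi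g|\Big).$$
   Formalization: The kernel in the representation is taken as −J(t)+J̃(x,t) instead of J(t)+J̃(x,t): with the equation D'+JD=A_μD the first iterate carries a minus sign, and with +J(t) the bound fails for σ_1=σ_2=1 and large real μ. *)

(* Defs.v *)
From mathcomp Require Import all_boot all_order all_algebra.
From mathcomp Require Import complex.
From mathcomp Require Import all_classical all_reals all_analysis.

Set Implicit Arguments.
Unset Strict Implicit.
Unset Printing Implicit Defensive.

Import Order.TTheory GRing.Theory Num.Theory.
Import numFieldNormedType.Exports.

Local Open Scope classical_set_scope.
Local Open Scope ring_scope.
Local Open Scope complex_scope.

(* The bare names would otherwise denote Num.Re and Num.Im. *)
Local Notation Re := complex.Re.
Local Notation Im := complex.Im.

(* [complex.v] has the modulus only as an element of R[i]; its real-valued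
   version [normc] is not exported. *)
Notation cmod := (ComplexField.Normc.normc).

Section ComplexAnalysis.
Variable R : realType.
Implicit Types (f : R -> R[i]) (F : R -> 'M[R[i]]_2).

Definition cexp (z : R[i]) : R[i] :=
  (expR (Re z) * cos (Im z)) +i* (expR (Re z) * sin (Im z)).

Definition clim (u : nat -> R[i]) : R[i] :=
  limn (fun n => Re (u n)) +i* limn (fun n => Im (u n)).

Definition mxexp (A : 'M[R[i]]_2) : 'M[R[i]]_2 :=
  \matrix_(i, j) clim (fun n => (\sum_(k < n) (k`!%:R^-1 *: A ^+ k)) i j).

Definition cintegrable (D : set R) f : Prop :=
  lebesgue_measure.-integrable D (fun t => (Re (f t))%:E) /\
  lebesgue_measure.-integrable D (fun t => (Im (f t))%:E).

(* Lebesgue integral over [a, b], only used for a <= b. *)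
Definition cint (a b : R) f : R[i] :=
  (\int[lebesgue_measure]_(t in `[a, b]) Re (f t)) +i*
  (\int[lebesgue_measure]_(t in `[a, b]) Im (f t)).

Definition mxint (a b : R) F : 'M[R[i]]_2 :=
  \matrix_(i, j) cint a b (fun t => F t i j).

(* Finite families of pairwise non-overlapping intervals [u i, v i]. *)
Definition abs_continuous (a b : R) f : Prop :=
  forall e : R, 0 < e -> exists2 d : R, 0 < d &
    forall (n : nat) (u v : 'I_n -> R),
      (forall i, [/\ a <= u i, u i <= v i & v i <= b]) ->
      (forall i j, i != j -> v i <= u j \/ v j <= u i) ->
      \sum_(i < n) (v i - u i) < d ->
      \sum_(i < n) cmod (f (v i) - f (u i)) < e.

Definition is_cderive (x : R) f (l : R[i]) : Prop :=
  is_derive x 1 (fun t => Re (f t)) (Re l) /\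
  is_derive x 1 (fun t => Im (f t)) (Im l).

Definition is_mxderive (x : R) F (L : 'M[R[i]]_2) : Prop :=
  forall i j, is_cderive x (fun t => F t i j) (L i j).

Definition mxnorm1 (M : 'M[R[i]]_2) : R := \sum_i \sum_j cmod (M i j).

End ComplexAnalysis.

Section Dirac.
Variable R : realType.
Implicit Types (s : R -> R[i]) (mu : R[i]).

Definition mx22 (a b c d : R[i]) : 'M[R[i]]_2 :=
  \matrix_(i, j) if i == 0 then (if j == 0 then a else b)
                 else (if j == 0 then c else d).

Definition J0 : 'M[R[i]]_2 := mx22 1 0 0 (-1).

Definition Jmx s1 s2 (x : R) : 'M[R[i]]_2 := mx22 0 (s1 x) (s2 x) 0.

Definition Amx mu : 'M[R[i]]_2 := ('i%C * mu) *: J0.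

Definition is_solution s1 s2 mu (D : R -> 'M[R[i]]_2) : Prop :=
  [/\ forall i j, abs_continuous 0 1 (fun x => D x i j),
      {ae lebesgue_measure, forall x : R, 0 <= x <= 1 ->
         exists2 D', is_mxderive x D D' &
                     D' + Jmx s1 s2 x *m D x = Amx mu *m D x}
    & D 0 = 1%:M].

(* For fixed x, the defining integral converges for a.e. t in [0, x]. *)
Definition Jtilde s1 s2 (x t : R) : 'M[R[i]]_2 :=
  mxint 0 (x - t) (fun xi => Jmx s1 s2 (t + xi) *m Jmx s1 s2 xi).

Definition strip (d : R) : set R[i] := [set mu | `|Im mu| <= d].

(* The supremum over x in [0, 1] of |int_0^x e^(ct) s(t) dt|. *)
Definition sup_osc (s : R -> R[i]) (c : R[i]) : R :=
  sup [set cmod (cint 0 x (fun t => cexp (c * t%:C) * s t)) | x in `[0, 1]].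

Definition Gamma s1 s2 mu : R :=
  (sup_osc s1 (- (2 * 'i%C * mu)) + sup_osc s1 (2 * 'i%C * mu)) +
  (sup_osc s2 (- (2 * 'i%C * mu)) + sup_osc s2 (2 * 'i%C * mu)).

(* Since J0 anticommutes with J, the first Picard iterate of D' + J D = A D is
     - int_0^x e^((x-t)A) J(t) e^(tA) dt = - int_0^x e^((x-2t)A) J(t) dt,
   so J(t) enters the kernel with a minus sign; the second iterate gives
   + Jtilde. With + J(t) and the same equation the remainder would not be
   O(Gamma^2), as s1 = s2 = 1 shows. *)
Definition dirac_kernel s1 s2 (x t : R) : 'M[R[i]]_2 :=
  - Jmx s1 s2 t + Jtilde s1 s2 x t.

End Dirac.

(* Main.v *)
Require Import Defs.
From HB Require Import structures.
From mathcomp Require Import all_boot all_order all_algebra.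
From mathcomp Require Import complex.
From mathcomp Require Import all_classical all_reals all_analysis.
From mathcomp Require Import measurable_realfun.
From mathcomp Require Import ring lra.

(** Put k = i mu and divide a column (y1, y2) of D by the free evolution:
    a = e^(- k x) y1 and b = e^(k x) y2 satisfy a' = - p b and b' = - q a, with
    p = e^(- 2 k t) s1 and q = e^(2 k t) s2.  In the strip, p and q are
    dominated by an integrable function that does not depend on mu.  Let P and
    Q be the primitives of p and q that vanish at 0.  For the column that starts
    at (1, 0), the remainder consists, up to the bounded factors e^(k x) and
    e^(- k x), of
      a - 1 - int_0^x q (P x - P)   and   b + Q,
    where the integral is the contribution of Jtilde, rewritten by Fubini's
    theorem and the substitution r = t + xi ([cint_shear]).

    Both are quadratic in sup |Q| ([remainder_quadratic]).  Indeed, with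
    w = - (b + Q) one has a' = p (Q + w) and w' = q (a - 1), so that
    (Q x - Q) (a - 1) + w has the derivative (Q x - Q) (Q + w) p and
      w x = int_0^x (Q x - Q) (Q + w) p.
    The term with (Q x - Q) Q is O(sup |Q|^2).  In the term with (Q x - Q) w the
    first factor is merely bounded, and Gronwall's inequality
    ([gronwall_integrable]) gives w = O(sup |Q|^2), with a constant that depends
    on the dominating function only.  Since
    a - 1 - int_0^x q (P x - P) = int_0^x p w, the first quantity follows.

    The column that starts at (0, 1) is the same problem for s2, s1 and - mu,
    with its two components exchanged.

    The coefficients being only integrable, derivatives exist almost everywhere
    and every such computation is integrated back by the fundamental theorem of
    calculus for absolutely continuous functions ([ac_FTC]).  It reduces, by
    Lebesgue differentiation, to the fact that an absolutely continuous function
    whose derivative vanishes almost everywhere is constant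
    ([ac_derive0_const]). *)

Set Implicit Arguments.
Unset Strict Implicit.
Unset Printing Implicit Defensive.

Import Order.TTheory GRing.Theory Num.Theory.
Import numFieldNormedType.Exports.

Local Open Scope classical_set_scope.
Local Open Scope ring_scope.

Local Notation Re := complex.Re.
Local Notation Im := complex.Im.

(** * Absolutely continuous functions with zero derivative *)
Section RealAbsoluteContinuity.
Variable R : realType.
Local Notation mu := (@lebesgue_measure R).
Implicit Types (a b x e : R) (f g h : R -> R).

(** Real induction: the supremum of the points of [a, b] that satisfy P is
    itself reached from a nearby point, and can be passed unless it is b. *)
Lemma itv_induction a b (P : R -> Prop) : a <= b -> P a ->
  (forall y, a <= y <= b -> exists2 r, 0 < r & forall u v, a <= u -> u <= y ->
     y <= v -> v <= b -> y - u < r -> v - y < r -> P u -> P v) ->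
  P b.
Proof.
move=> ab Pa step; pose S : set R := [set x | a <= x <= b /\ P x].
have Sa : S a by split; rewrite ?lexx.
have hS : has_sup S.
  split; first by exists a; exact: Sa.
  by exists b => x [/andP[]].
have as_ : a <= sup S by apply: ub_le_sup => //; exact: hS.2.
have sb : sup S <= b by apply: ge_sup => [|x [/andP[]]//]; exact: hS.1.
have [r r0 rP] := step (sup S) ltac:(by rewrite as_ sb).
have [u [/andP[au ub] Pu] su] := sup_adherent r0 hS.
have us : u <= sup S by apply: ub_le_sup; [exact: hS.2|split=> //; rewrite au].
pose v := Num.min b (sup S + r / 2).
have sv : sup S <= v by rewrite /v le_min sb; lra.
have vb : v <= b by rewrite /v ge_min lexx.
have vr : v - sup S < r.
  have : v <= sup S + r / 2 by rewrite /v ge_min lexx orbT.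
  lra.
have Pv : P v by apply: (rP u v) => //; lra.
have : v <= sup S.
  by apply: ub_le_sup; [exact: hS.2|split=> //; rewrite vb (le_trans as_)].
rewrite /v /Num.min; case: ifPn => [_ bs|_]; last by lra.
by move: Pv; rewrite /v /Num.min; have -> : b < sup S + r / 2 by lra.
Qed.

(** The real-valued counterpart of [abs_continuous], for the real and imaginary
    parts. *)
Definition ac a b f := forall e, 0 < e -> exists2 d, 0 < d &
  forall (n : nat) (u v : 'I_n -> R),
    (forall i, [/\ a <= u i, u i <= v i & v i <= b]) ->
    (forall i j, i != j -> v i <= u j \/ v j <= u i) ->
    \sum_(i < n) (v i - u i) < d ->
    \sum_(i < n) `|f (v i) - f (u i)| < e.

(** A covering argument along [a, b].  The points without zero derivative lie in
    an open set U of small measure.  On a short interval around a point outside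
    this exceptional set, h varies by at most e times the length; a short
    interval around an exceptional point is contained in U and is put aside.
    The total length of the latter is at most the measure of U, so that absolute
    continuity bounds the variation of h over them. *)
Lemma ac_derive0_const a b h : a <= b -> ac a b h ->
  {ae mu, forall x, a <= x <= b -> is_derive x 1 h 0} -> h b = h a.
Proof.
move=> ab ach [N [mN N0 NP]].
suff E e : 0 < e -> `|h b - h a| <= e * (b - a) + e.
  apply/eqP; rewrite -subr_eq0 -normr_le0; apply/ler_addgt0Pr => e e0.
  rewrite add0r.
  have k0 : 0 < b - a + 1 by lra.
  apply: (le_trans (E (e / (b - a + 1)) _)); first exact: divr_gt0.
  by rewrite -[X in _ + X]mulr1 -mulrDr divfK// gt_eqF.
move=> e0; have [d d0 dP] := ach e e0.
have Ny : (mu N < +oo)%E by rewrite N0 ltry.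
have [U [oU NU mU]] := lebesgue_regularity_outer mN Ny d0.
have mmU : measurable U by exact: open_measurable.
have {}mU : (mu U < d%:E)%E.
  apply: le_lt_trans mU; rewrite -(setDUK NU) (le_trans (measureU2 _ _ _))//.
    exact: measurableD.
  by rewrite [X in (X + _)%E]N0 add0e setDUK.
(* The n intervals [u i, v i] put aside so far are consecutive, and their total
   length is controlled by the part of U already crossed. *)
pose P x := exists n (u v : nat -> R),
  [/\ forall i, (i < n)%N -> [/\ a <= u i, u i <= v i & v i <= x],
      forall i j, (i < j < n)%N -> v i <= u j,
      ((\sum_(i < n) (v i - u i))%:E <= mu (U `&` `]a, x]))%E &
      `|h x - h a| <= e * (x - a) + \sum_(i < n) `|h (v i) - h (u i)|].
suff [n [u [v [uv vu le_d hE]]]] : P b.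
  apply: (le_trans hE); rewrite lerD2l ltW//.
  apply: (dP n (fun i : 'I_n => u i) (fun i : 'I_n => v i)).
  - by move=> i; exact: uv.
  - move=> i j ij; have [lt_ij|lt_ji|/val_inj eq_ij] := ltngtP i j.
    + by left; apply: vu; rewrite lt_ij ltn_ord.
    + by right; apply: vu; rewrite lt_ji ltn_ord.
    + by rewrite eq_ij eqxx in ij.
  - rewrite -lte_fin (le_lt_trans le_d)// (le_lt_trans _ mU)//.
    by apply: le_measure; rewrite ?inE//; exact: measurableI.
apply: (itv_induction ab).
  exists 0%N, (fun=> 0), (fun=> 0); split => //.
  - by rewrite big_ord0 measure_ge0.
  - by rewrite !subrr normr0 mulr0 add0r big_ord0.
move=> y /andP[ay yb].
have [yN|yN] := pselect (N y).
  have /= [r /= r0 rU] : \forall r \near 0^'+, ball y r `<=` U.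
    by apply: open_subball => //; exact: NU.
  have {}rU : ball y (r / 2) `<=` U.
    apply: rU; rewrite /=; last by lra.
    by rewrite sub0r normrN gtr0_norm; lra.
  exists (r / 2); first lra.
  move=> u v au uy yv vb yu vy [n [u' [v' [uv vu le_d hE]]]].
  have uvU : `]u, v] `<=` U.
    move=> z /=; rewrite in_itv/= => /andP[uz zv]; apply: rU.
    by rewrite /ball/= ltr_distl; apply/andP; split; lra.
  exists n.+1, (fun i => if (i < n)%N then u' i else u),
    (fun i => if (i < n)%N then v' i else v); split.
  - move=> i _; case: ifPn => [/uv[? ? ?]|_]; split => //; lra.
  - move=> i j; rewrite ltnS => /andP[ij jn]; rewrite (leq_trans ij jn).
    case: ifPn => jn'; first by apply: vu; rewrite ij.
    by have [] := uv i (leq_trans ij jn).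
  - rewrite big_ord_recr/= ltnn EFinD.
    rewrite (_ : U `&` `]a, v] = (U `&` `]a, u]) `|` `]u, v]); last first.
      rewrite eqEsubset; split=> z /=; rewrite !in_itv/=.
        move=> [Uz /andP[az zv]]; have [zu|zu] := leP z u.
          by left; rewrite az.
        by right.
      move=> [[Uz /andP[az zu]]|/andP[uz zv]]; first by rewrite az;
        split=> //=; lra.
      split; first by apply: uvU; rewrite /= in_itv/= uz.
      by apply/andP; split; lra.
    rewrite measureU//; last 2 first.
    + exact: measurableI.
    + rewrite -subset0 => z [[_]] /=;
      rewrite !in_itv/= => /andP[_ zu] /andP[uz _].
      lra.
    apply: leeD.
      by under eq_bigr do rewrite ltn_ord.
    rewrite -[X in (_ <= X)%E]/(mu `]u, v]%classic).
    rewrite lebesgue_measure_itv/= lte_fin; case: ifPn => // vu'.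
    by rewrite lee_fin; lra.
  - rewrite big_ord_recr/= ltnn; under eq_bigr do rewrite ltn_ord.
    rewrite (_ : h v - h a = (h u - h a) + (h v - h u)); last by ring.
    rewrite (le_trans (ler_normD _ _))// addrA lerD2r (le_trans hE)// lerD2r.
    by rewrite ler_pM2l//; lra.
have hy : is_derive y 1 h 0.
  by apply: contrapT => H; apply: yN; apply: NP => /= /(_ ltac:(by rewrite ay)).
have [r r0 rP] : exists2 r, 0 < r & forall z, `|z - y| < r ->
  `|h z - h y| <= e * `|z - y|.
  have := @derivable1_diffP _ _ h y.
  have [/cvg_ex[/= l hl] dE] := hy.
  have lE : l = 0 by rewrite -dE; apply/esym/cvg_lim.
  move: hl; rewrite {}lE => /cvgrPdist_le/(_ _ e0)[r /= r0 rP] _.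
  exists r => // z zr; have [->|zy] := eqVneq z y.
    by rewrite !subrr normr0 mulr0.
  have := rP (z - y); rewrite /= sub0r normrN zr subr_eq0 zy.
  move=> /(_ isT isT); rewrite /= sub0r normrN normrZ normfV.
  rewrite [_%:A]mulr1 subrK ler_pdivrMl ?normr_gt0 ?subr_eq0//.
  by rewrite mulrC.
exists r => // u v au uy yv vb yu vy [n [u' [v' [uv vu le_d hE]]]].
exists n, u', v'; split => //.
- by move=> i /uv[? ? ?]; split => //; lra.
- apply: (le_trans le_d); apply: le_measure; rewrite ?inE.
  + exact: measurableI.
  + exact: measurableI.
  + by apply: setIS => z /=; rewrite !in_itv/= => /andP[-> ?]/=; lra.
- rewrite (_ : h v - h a = (h u - h a) + ((h v - h y) - (h u - h y)));
  last by ring.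
  rewrite (le_trans (ler_normD _ _))//.
  have h1 : `|h v - h y| <= e * (v - y).
    by rewrite -[v - y]ger0_norm ?subr_ge0//; apply: rP;
      rewrite ger0_norm ?subr_ge0.
  have h2 : `|h u - h y| <= e * (y - u).
    rewrite -[y - u]ger0_norm ?subr_ge0// [X in e * X]distrC; apply: rP.
    by rewrite distrC ger0_norm ?subr_ge0.
  have := ler_normB (h v - h y) (h u - h y).
  rewrite !mulrBr in h1 h2 hE *; lra.
Qed.

End RealAbsoluteContinuity.

(** * Operations on absolutely continuous functions *)
Section RealACAlgebra.
Variable R : realType.
Local Notation mu := (@lebesgue_measure R).
Implicit Types (a b x e : R) (f g h : R -> R).

Lemma ac_sub a b c d f : a <= c -> d <= b -> ac a b f -> ac c d f.
Proof.
move=> ac db acf e /acf[k k0 kP]; exists k => // n u v uv; apply: kP => i.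
by have [? ? ?] := uv i; split => //; lra.
Qed.

Lemma ac_ext a b f g : (forall x, a <= x <= b -> f x = g x) -> ac a b f ->
  ac a b g.
Proof.
move=> fg acf e /acf[d d0 dP]; exists d => // n u v uv no lt_d.
rewrite (eq_bigr (fun i => `|f (v i) - f (u i)|)) ?dP// => i _.
by have [? ? ?] := uv i; rewrite !fg//; apply/andP; split; lra.
Qed.

Lemma ac_lipschitz a b k f :
  (forall x y, a <= x -> x <= y -> y <= b -> `|f y - f x| <= k * (y - x)) ->
  ac a b f.
Proof.
move=> fk e e0; have k0 : 0 < `|k| + 1 by rewrite ltr_pwDr.
exists (e / (`|k| + 1)); first exact: divr_gt0.
move=> n u v uv _ lt_d.
apply: (@le_lt_trans _ _ (\sum_(i < n) ((`|k| + 1) * (v i - u i)))).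
  apply: ler_sum => i _; have [? ? ?] := uv i;
    apply: (le_trans (fk _ _ _ _ _)) => //.
  rewrite ler_wpM2r ?subr_ge0// (le_trans (ler_norm k))//; lra.
by rewrite -mulr_sumr mulrC -ltr_pdivlMr.
Qed.

Lemma ac_cst a b k : ac a b (fun=> k).
Proof.
by apply: (@ac_lipschitz _ _ 0) => x y _ _ _; rewrite subrr normr0 mul0r.
Qed.

Lemma acD a b f g : ac a b f -> ac a b g -> ac a b (fun x => f x + g x).
Proof.
move=> acf acg e e0; have e20 : 0 < e / 2 by lra.
have [d d0 dP] := acf _ e20; have [d' d'0 d'P] := acg _ e20.
exists (Num.min d d'); first by rewrite lt_min d0.
move=> n u v uv no; rewrite lt_min =>
  /andP[/(dP n u v uv no) h1 /(d'P n u v uv no) h2].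
apply: (@le_lt_trans _ _ (\sum_(i < n) (`|f (v i) - f (u i)| + `|g (v i) - g
  (u i)|))).
  apply: ler_sum => i _; apply: le_trans (ler_normD _ _).
  by rewrite opprD addrACA.
by rewrite big_split/=; lra.
Qed.

Lemma acN a b f : ac a b f -> ac a b (fun x => - f x).
Proof.
move=> acf e /acf[d d0 dP]; exists d => // n u v uv no /(dP n u v uv no).
by under eq_bigr do rewrite distrC -[X in `|X - _|]opprK addrC.
Qed.

Lemma acB a b f g : ac a b f -> ac a b g -> ac a b (fun x => f x - g x).
Proof. by move=> acf acg; apply: acD => //; exact: acN. Qed.

(** The case of a single interval. *)
Lemma ac_modulus a b f e : ac a b f -> 0 < e -> exists2 d, 0 < d &
  forall u v, a <= u -> u <= v -> v <= b -> v - u < d -> `|f v - f u| < e.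
Proof.
move=> acf /acf[d d0 dP]; exists d => // u v au uv vb uvd.
have := dP 1%N (fun=> u) (fun=> v); rewrite !big_ord1; apply => //.
by move=> i j; rewrite !ord1 eqxx.
Qed.

Lemma ac_continuous a b f : ac a b f -> {within `[a, b], continuous f}.
Proof.
move=> acf; apply/subspace_continuousP => x /=;
  rewrite in_itv/= => /andP[ax xb].
apply/cvgrPdist_lt => e e0; have [d d0 ac2] := ac_modulus acf e0.
rewrite near_withinE; near=> y.
rewrite /= in_itv/= => /andP[ay yb].
have xyd : `|x - y| < d by near: y; exact: cvgr_dist_lt.
have [xy|/ltW yx] := leP x y.
  by rewrite distrC; apply: ac2 => //;
    rewrite -(ger0_norm (_ : 0 <= y - x)) ?subr_ge0// distrC.
by apply: ac2 => //; rewrite -(ger0_norm (_ : 0 <= x - y)) ?subr_ge0.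
Unshelve. all: by end_near. Qed.

Lemma within_continuous_bounded a b f : {within `[a, b], continuous f} ->
  exists2 k, 0 < k & forall x, a <= x <= b -> `|f x| <= k.
Proof.
move=> cf; have [ab|ba] := leP a b; last first.
  by exists 1 => // x /andP[ax xb]; exfalso; lra.
have [c _ fc] := EVT_max ab cf; have [c' _ fc'] := EVT_min ab cf.
exists (`|f c| + `|f c'| + 1); first by rewrite ltr_pwDr// addr_ge0.
move=> x xab; have xI : x \in `[a, b] by rewrite in_itv.
have := fc x xI; have := fc' x xI; have := ler_norm (f c).
have := ler_norm (- f c'); rewrite normrN => *.
have := normr_ge0 (f c); have := normr_ge0 (f c') => *.
by rewrite ler_norml; apply/andP; split; lra.
Qed.

Lemma acM a b f g : ac a b f -> ac a b g -> ac a b (fun x => f x * g x).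
Proof.
move=> acf acg.
have [k k0 fk] := within_continuous_bounded (ac_continuous acf).
have [l l0 gl] := within_continuous_bounded (ac_continuous acg).
move=> e e0.
have [d d0 dP] := acf (e / (2 * l)) ltac:(by rewrite divr_gt0// mulr_gt0).
have [d' d'0 d'P] := acg (e / (2 * k)) ltac:(by rewrite divr_gt0// mulr_gt0).
exists (Num.min d d'); first by rewrite lt_min d0.
move=> n u v uv no; rewrite lt_min =>
  /andP[/(dP n u v uv no) h1 /(d'P n u v uv no) h2].
apply: (@le_lt_trans _ _
    (\sum_(i < n) (k * `|g (v i) - g (u i)| + l * `|f (v i) - f (u i)|))).
  apply: ler_sum => i _; have [? ? ?] := uv i.
  rewrite (_ : _ - _ = f (v i) * (g (v i) - g (u i)) + (f (v i) - f (u i)) * g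
    (u i)); last by ring.
  rewrite (le_trans (ler_normD _ _))// !normrM [X in _ + X]mulrC.
  apply: lerD; rewrite ler_wpM2r//; [apply: fk|apply: gl]; apply/andP; split;
    lra.
rewrite big_split/= -!mulr_sumr.
have -> : e = k * (e / (2 * k)) + l * (e / (2 * l)).
  by field; rewrite !gt_eqF.
by apply: ltrD; rewrite ltr_pM2l.
Qed.

End RealACAlgebra.

(** * The fundamental theorem of calculus *)
Section PrimitiveAC.
Variable R : realType.
Local Notation mu := (@lebesgue_measure R).
Implicit Types (a b x e : R) (f g h : R -> R).

Lemma ae_imp (P Q : R -> Prop) : {ae mu, forall x, P x} ->
  (forall x, P x -> Q x) -> {ae mu, forall x, Q x}.
Proof.
by move=> aeP PQ; apply: filterS PQ aeP; exact: (ae_filter_ringOfSetsType mu).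
Qed.

Lemma ae_imp2 (P Q S : R -> Prop) : {ae mu, forall x, P x} ->
  {ae mu, forall x, Q x} -> (forall x, P x -> Q x -> S x) ->
  {ae mu, forall x, S x}.
Proof.
move=> aeP aeQ PQS; apply: filterS2 PQS aeP aeQ.
exact: (ae_filter_ringOfSetsType mu).
Qed.

Local Notation integrable_on a b f := (mu.-integrable `[a, b] (EFin \o f)).

Lemma integrable_on_sub a b c d f : a <= c -> d <= b ->
  integrable_on a b f -> integrable_on c d f.
Proof.
move=> ac db; apply: integrableS => //.
by apply: subset_itv; rewrite bnd_simp.
Qed.

Lemma integrable_onZ a b k f : integrable_on a b f ->
  integrable_on a b (fun t => k * f t).
Proof. by move=> intf; apply: eq_integrable (integrableZl _ k intf). Qed.

Lemma Rintegral_itv_chasles a x b f : a <= x -> x <= b -> integrable_on a b f ->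
  \int[mu]_(t in `[a, b]) f t =
  \int[mu]_(t in `[a, x]) f t + \int[mu]_(t in `[x, b]) f t.
Proof.
move=> ax xb intf; have := Rintegral_itvB intf (x := x).
rewrite !bnd_simp => /(_ ax xb).
rewrite Rintegral_itv_obnd_cbnd => [H|]; first by rewrite -H addrC subrK.
by apply: integrableS intf => //; apply: subset_itv; rewrite bnd_simp.
Qed.

(** The half-open intervals ]u i, v i] are disjoint, so the increments of the
    primitive are bounded by the integral of |f| over a set of small measure. *)
Lemma ac_primitive a b f : integrable_on a b f ->
  ac a b (fun x => \int[mu]_(t in `[a, x]) f t).
Proof.
move=> intf e e0.
pose g := f \_ `[a, b].
have intg : mu.-integrable setT (EFin \o g).
  by rewrite -restrict_EFin; apply/integrable_restrict => //=; rewrite setTI.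
have [d [d0 dP]] := integral_normr_continuous intg e0.
exists d => // n u v uv no lt_d.
pose A := \big[setU/set0]_(i <- index_enum 'I_n) `]u i, v i]%classic.
have tI : trivIset [set` index_enum 'I_n] (fun i => `]u i, v i]%classic).
  apply/trivIsetP => i j _ _ ij; rewrite -subset0 => z [] /=; rewrite !in_itv/=.
  move=> /andP[? ?] /andP[? ?]; have [] := no i j ij; lra.
have mA : measurable A by exact: bigsetU_measurable.
have mgA : measurable_fun A (fun x => `|(g x)%:E|%E).
  apply: measurable_funTS; apply: measurableT_comp => //;
    exact: (measurable_int mu).
have muA : (mu A < d%:E)%E.
  rewrite /A measure_bigsetU_ord//; last by move: tI;
    rewrite (_ : [set` _] = setT)//; apply/seteqP; split => // i _ /=;
    rewrite mem_index_enum.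
  rewrite (eq_bigr (fun i => (v i - u i)%:E)).
    by rewrite sumEFin lte_fin.
  move=> i _; have [_ uvi _] := uv i.
  rewrite -[LHS]/(mu `]u i, v i]%classic) lebesgue_measure_itv/= lte_fin.
  case: ifPn => // ; rewrite -leNgt => vu; congr EFin; lra.
have lt_e := dP A mA muA.
apply: le_lt_trans lt_e.
rewrite /Rintegral.
rewrite (_ : (\int[mu]_(x in A) `|g x|%:E)%E =
  (\sum_(i < n) \int[mu]_(x in `]u i, v i]) `|g x|%:E)%E); last first.
  rewrite /A (@ge0_integral_bigsetU _ _ _ mu _ (fun i =>
    `]u i, v i]%classic))//.
  by rewrite index_enum_uniq.
have intgi i : mu.-integrable `]u i, v i] (EFin \o (fun x => `|g x|)).
  by apply: (@integrableS _ _ _ mu setT) => //; exact: integrable_norm.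
rewrite (eq_bigr (fun i => (\int[mu]_(x in `]u i, v i]) `|g x|)%:E));
  last first.
  by move=> i _; rewrite /Rintegral fineK//; exact: integrable_fin_num.
rewrite sumEFin/=.
apply: ler_sum => i _; have [? ? ?] := uv i.
rewrite Rintegral_itvB ?bnd_simp//; last by apply: integrable_on_sub intf.
rewrite (@eq_Rintegral _ _ _ mu _ g) => [|x]; last first.
  rewrite inE/= in_itv/= => /andP[? ?]; rewrite /g patchE mem_set//= in_itv/=.
  by apply/andP; split; lra.
apply: le_normr_Rintegral => //.
by apply: (@integrableS _ _ _ mu setT).
Qed.

(** Lebesgue differentiation for the extension of f by zero, whose primitive
    coincides with that of f near every point of ]a, b[. *)
Lemma primitive_derive a b f : integrable_on a b f ->
  {ae mu, forall x, a <= x <= b ->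
    is_derive x 1 (fun x => \int[mu]_(t in `[a, x]) f t) (f x)}.
Proof.
move=> intf; pose g := f \_ `[a, b].
have intg : mu.-integrable setT (EFin \o g).
  by rewrite -restrict_EFin; apply/integrable_restrict => //=; rewrite setTI.
have intgy (i : interval R) : mu.-integrable [set` i] (EFin \o g).
  exact: integrableS intg.
have locg : locally_integrable setT g.
  by apply: open_integrable_locally => //; exact: openT.
have := FTC1 (a := BLeft a) (fun y => intgy _) locg.
have aeN (c : R) : {ae mu, forall x, x != c}.
  exists [set c]; split => //; first exact: lebesgue_measure_set1.
  by move=> x /= /negP; rewrite negbK => /eqP.
move=> H; apply: ae_imp2 H (ae_imp2 (aeN a) (aeN b) (fun x => @conj _ _)) _ =>
  x H [xa xb] /andP[ax xb'].
have {}xa : a < x by rewrite lt_neqAle eq_sym xa.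
have {}xb : x < b by rewrite lt_neqAle xb.
have [] := H ltac:(by rewrite lte_fin).
rewrite [g x]patchE mem_set; last by rewrite /= in_itv/= ax.
move=> dG GE; rewrite derive1E in GE.
have : is_derive x 1 (fun x => \int[mu]_(t in `[a, x]) g t) (f x) by split.
apply: near_eq_is_derive.
near=> y; apply: eq_Rintegral => z; rewrite inE/= in_itv/= => /andP[az zy].
rewrite /g patchE mem_set//= in_itv/= az/= (le_trans zy)//.
by near: y; exact: (cvgr_le x).
Unshelve. all: by end_near. Qed.

Lemma ac_FTC a b f g : a <= b -> ac a b f -> integrable_on a b g ->
  {ae mu, forall x, a <= x <= b -> is_derive x 1 f (g x)} ->
  \int[mu]_(t in `[a, b]) g t = f b - f a.
Proof.
move=> ab acf intg df.
pose G x := \int[mu]_(t in `[a, x]) g t.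
have /esym/eqP : f b - G b = f a - G a.
  apply: (@ac_derive0_const _ a b (fun x => f x - G x)) => //.
    by apply: acB => //; exact: ac_primitive.
  refine (ae_imp2 df (primitive_derive intg) _) => x fx gx xab.
  have {}fx := fx xab; have {}gx := gx xab.
  by have := is_deriveB fx gx; rewrite subrr.
by rewrite /G set_itv1 Rintegral_set1 subr0 eq_sym subr_eq => /eqP ->;
  rewrite addrC addKr.
Qed.

End PrimitiveAC.

(** * Complex-valued calculus through real and imaginary parts *)
Section ComplexParts.
Variable R : realType.
Implicit Types z w : R[i].

Lemma complex_eqP z w : Re z = Re w -> Im z = Im w -> z = w.
Proof. by case: z => a b; case: w => c d /= -> ->. Qed.

Lemma cReD z w : Re (z + w) = Re z + Re w. Proof. by case: z; case: w. Qed.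
Lemma cImD z w : Im (z + w) = Im z + Im w. Proof. by case: z; case: w. Qed.
Lemma cReN z : Re (- z) = - Re z. Proof. by case: z. Qed.
Lemma cImN z : Im (- z) = - Im z. Proof. by case: z. Qed.
Lemma cReM z w : Re (z * w) = Re z * Re w - Im z * Im w.
Proof. by case: z; case: w. Qed.
Lemma cImM z w : Im (z * w) = Re z * Im w + Im z * Re w.
Proof. by case: z; case: w. Qed.

Lemma normr_Re_le z : `|Re z| <= cmod z.
Proof.
case: z => a b /=; rewrite -sqrtr_sqr ler_wsqrtr// lerDl; exact: sqr_ge0.
Qed.

Lemma normr_Im_le z : `|Im z| <= cmod z.
Proof.
case: z => a b /=; rewrite -sqrtr_sqr ler_wsqrtr// lerDr; exact: sqr_ge0.
Qed.

Lemma cmod_ge0 z : 0 <= cmod z.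
Proof. by case: z => a b /=; exact: sqrtr_ge0. Qed.

Lemma cmodD z w : cmod (z + w) <= cmod z + cmod w.
Proof. exact: le_normcD. Qed.

Lemma cmodM z w : cmod (z * w) = cmod z * cmod w.
Proof. exact: ComplexField.Normc.normcM. Qed.

Lemma cmodN z : cmod (- z) = cmod z.
Proof. exact: normcN. Qed.

Lemma cmodB z w : cmod (z - w) <= cmod z + cmod w.
Proof. by rewrite (le_trans (cmodD _ _))// cmodN. Qed.

Lemma cmod_le_parts z : cmod z <= `|Re z| + `|Im z|.
Proof.
case: z => a b /=; rewrite -[leRHS]ger0_norm ?addr_ge0//.
rewrite -sqrtr_sqr ler_wsqrtr// sqrrD !real_normK ?num_real//.
by rewrite -addrA [X in _ <= _ + X]addrC addrA lerDl mulrn_wge0// mulr_ge0.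
Qed.

End ComplexParts.

Section ComplexCalculus.
Variable R : realType.
Local Notation mu := (@lebesgue_measure R).
Implicit Types (a b x : R) (f g h : R -> R[i]).

Definition cac a b f :=
  ac a b (fun t => Re (f t)) /\ ac a b (fun t => Im (f t)).

Lemma abs_continuous_cac a b f : abs_continuous a b f -> cac a b f.
Proof.
by move=> acf; split => e /acf[d d0 dP]; exists d => // n u v uv no lt_d;
  apply: le_lt_trans (dP n u v uv no lt_d); apply: ler_sum => i _;
  rewrite -?cReN -?cReD -?cImN -?cImD; [exact: normr_Re_le|exact: normr_Im_le].
Qed.

Lemma cac_sub a b c d f : a <= c -> d <= b -> cac a b f -> cac c d f.
Proof. by move=> ca db [fr fi]; split; [exact: ac_sub fr|exact: ac_sub fi]. Qed.

Lemma cac_cst a b (k : R[i]) : cac a b (fun=> k).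
Proof. by split; exact: ac_cst. Qed.

Lemma cacD a b f g : cac a b f -> cac a b g -> cac a b (fun t => f t + g t).
Proof.
move=> [fr fi] [gr gi]; split.
  by apply: ac_ext (acD fr gr) => t _; rewrite cReD.
by apply: ac_ext (acD fi gi) => t _; rewrite cImD.
Qed.

Lemma cacN a b f : cac a b f -> cac a b (fun t => - f t).
Proof.
move=> [fr fi]; split.
  by apply: ac_ext (acN fr) => t _; rewrite cReN.
by apply: ac_ext (acN fi) => t _; rewrite cImN.
Qed.

Lemma cacB a b f g : cac a b f -> cac a b g -> cac a b (fun t => f t - g t).
Proof. by move=> cf cg; apply: cacD => //; exact: cacN. Qed.

Lemma cacM a b f g : cac a b f -> cac a b g -> cac a b (fun t => f t * g t).
Proof.
move=> [fr fi] [gr gi]; split.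
  by apply: ac_ext (acB (acM fr gr) (acM fi gi)) => t _; rewrite cReM.
by apply: ac_ext (acD (acM fr gi) (acM fi gr)) => t _; rewrite cImM.
Qed.

Lemma is_derive_ext x (u v : R -> R) (l m : R) : is_derive x 1 u l ->
  u =1 v -> l = m -> is_derive x 1 v m.
Proof. by move=> du /funext <- <-. Qed.

Lemma is_cderive_eq x f (l m : R[i]) : is_cderive x f l -> l = m ->
  is_cderive x f m.
Proof. by move=> + <-. Qed.

Lemma is_cderive_cst x (k : R[i]) : is_cderive x (fun=> k) 0.
Proof. by split; exact: is_derive_cst. Qed.

Lemma is_cderiveD x f g (l m : R[i]) : is_cderive x f l -> is_cderive x g m ->
  is_cderive x (fun t => f t + g t) (l + m).
Proof.
move=> [fr fi] [gr gi]; split.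
  by apply: (is_derive_ext (is_deriveD fr gr)) => [t|]; rewrite cReD.
by apply: (is_derive_ext (is_deriveD fi gi)) => [t|]; rewrite cImD.
Qed.

Lemma is_cderiveN x f (l : R[i]) : is_cderive x f l ->
  is_cderive x (fun t => - f t) (- l).
Proof.
move=> [fr fi]; split.
  by apply: (is_derive_ext (is_deriveN fr)) => [t|]; rewrite cReN.
by apply: (is_derive_ext (is_deriveN fi)) => [t|]; rewrite cImN.
Qed.

Lemma is_cderiveB x f g (l m : R[i]) : is_cderive x f l -> is_cderive x g m ->
  is_cderive x (fun t => f t - g t) (l - m).
Proof. by move=> df dg; apply: is_cderiveD => //; exact: is_cderiveN. Qed.

Lemma is_cderiveM x f g (l m : R[i]) : is_cderive x f l -> is_cderive x g m ->
  is_cderive x (fun t => f t * g t) (l * g x + f x * m).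
Proof.
move=> [fr fi] [gr gi]; split.
  apply: (is_derive_ext (is_deriveB (is_deriveM fr gr) (is_deriveM fi gi))).
    by move=> t; rewrite cReM.
  by rewrite cReD !cReM /GRing.scale/=; ring.
apply: (is_derive_ext (is_deriveD (is_deriveM fr gi) (is_deriveM fi gr))).
  by move=> t; rewrite cImM.
by rewrite cImD !cImM /GRing.scale/=; ring.
Qed.

Lemma cintegrable_sub a b c d f : a <= c -> d <= b ->
  cintegrable `[a, b] f -> cintegrable `[c, d] f.
Proof.
by move=> ca db [fr fi]; split;
  [exact: (integrable_on_sub ca db fr)|exact: (integrable_on_sub ca db fi)].
Qed.

Lemma cintegrable_eq a b f g : (forall t, a <= t <= b -> f t = g t) ->
  cintegrable `[a, b] f -> cintegrable `[a, b] g.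
Proof.
by move=> fg [fr fi]; split; [apply: eq_integrable fr|apply: eq_integrable fi];
  rewrite //= => t; rewrite inE/= in_itv/= => /fg ->.
Qed.

Lemma cintegrableD a b f g : cintegrable `[a, b] f -> cintegrable `[a, b] g ->
  cintegrable `[a, b] (fun t => f t + g t).
Proof.
move=> [fr fi] [gr gi]; split.
  by apply: eq_integrable (integrableD _ fr gr) => //= t _; rewrite cReD.
by apply: eq_integrable (integrableD _ fi gi) => //= t _; rewrite cImD.
Qed.

Lemma ac_integrableM a b (u v : R -> R) : ac a b u ->
  mu.-integrable `[a, b] (EFin \o v) ->
  mu.-integrable `[a, b] (EFin \o (fun t => u t * v t)).
Proof.
move=> acu intv; have cu := ac_continuous acu.
have [k k0 uk] := within_continuous_bounded cu.
apply: (integrableMr _ _ _ intv) => //.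
  exact: subspace_continuous_measurable_fun.
exists k; split; first exact: num_real.
move=> M kM t /=; rewrite in_itv/= => /uk /le_trans; apply; exact: ltW.
Qed.

Lemma cac_cintegrableM a b f g : cac a b f -> cintegrable `[a, b] g ->
  cintegrable `[a, b] (fun t => f t * g t).
Proof.
move=> [fr fi] [gr gi]; split.
  apply: eq_integrable (integrableB _ (ac_integrableM fr gr)
    (ac_integrableM fi gi)) => //=.
  by move=> t _; rewrite cReM.
apply: eq_integrable (integrableD _ (ac_integrableM fr gi)
  (ac_integrableM fi gr)) => //=.
by move=> t _; rewrite cImM.
Qed.

Lemma cint_eq a b f g : (forall t, a <= t <= b -> f t = g t) ->
  cint a b f = cint a b g.
Proof.
move=> fg; apply: complex_eqP => /=; apply: eq_Rintegral => t;
  by rewrite inE/= in_itv/= => /fg ->.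
Qed.

Lemma cintD a b f g : cintegrable `[a, b] f -> cintegrable `[a, b] g ->
  cint a b (fun t => f t + g t) = cint a b f + cint a b g.
Proof.
move=> [fr fi] [gr gi]; apply: complex_eqP; rewrite ?cReD ?cImD /=.
  by under eq_Rintegral do rewrite cReD; rewrite RintegralD.
by under eq_Rintegral do rewrite cImD; rewrite RintegralD.
Qed.

Lemma cintZ a b (k : R[i]) f : cintegrable `[a, b] f ->
  cint a b (fun t => k * f t) = k * cint a b f.
Proof.
move=> [fr fi].
apply: complex_eqP; rewrite ?cReM ?cImM /=.
  under eq_Rintegral do rewrite cReM.
  by rewrite RintegralB ?RintegralZl//; exact: integrable_onZ.
under eq_Rintegral do rewrite cImM.
by rewrite RintegralD ?RintegralZl//; exact: integrable_onZ.
Qed.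

Lemma cint_pt a f : cint a a f = 0.
Proof. by apply: complex_eqP => /=; rewrite set_itv1 Rintegral_set1. Qed.

Lemma cint_chasles a x b f : a <= x -> x <= b -> cintegrable `[a, b] f ->
  cint a b f = cint a x f + cint x b f.
Proof.
move=> ax xb [fr fi]; apply: complex_eqP; rewrite ?cReD ?cImD/=;
  exact: Rintegral_itv_chasles.
Qed.

(** The factor 2 comes from bounding the real and imaginary parts separately. *)
Lemma cmod_cint_le a b f (g : R -> R) : cintegrable `[a, b] f ->
  mu.-integrable `[a, b] (EFin \o g) ->
  (forall t, a <= t <= b -> cmod (f t) <= g t) ->
  cmod (cint a b f) <= 2 * \int[mu]_(t in `[a, b]) g t.
Proof.
move=> [fr fi] intg fg; apply: (le_trans (cmod_le_parts _)) => /=.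
rewrite mulr2n mulrDl mul1r; apply: lerD.
  apply: (le_trans (le_normr_Rintegral _ _)) => //.
  apply: le_Rintegral => //; first exact: integrable_norm.
  by move=> t /=; rewrite in_itv/= => /fg; apply: le_trans; exact: normr_Re_le.
apply: (le_trans (le_normr_Rintegral _ _)) => //.
apply: le_Rintegral => //; first exact: integrable_norm.
by move=> t /=; rewrite in_itv/= => /fg; apply: le_trans; exact: normr_Im_le.
Qed.

Lemma cac_primitive a b f : cintegrable `[a, b] f ->
  cac a b (fun x => cint a x f).
Proof. by move=> [fr fi]; split; exact: ac_primitive. Qed.

Lemma cprimitive_derive a b f : cintegrable `[a, b] f ->
  {ae mu, forall x, a <= x <= b -> is_cderive x (fun x => cint a x f) (f x)}.
Proof.
move=> [fr fi]; refine (ae_imp2 (primitive_derive fr) (primitive_derive fi) _).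
by move=> x dr di xab; split; [exact: dr|exact: di].
Qed.

Lemma cac_FTC a b f g : a <= b -> cac a b f -> cintegrable `[a, b] g ->
  {ae mu, forall x, a <= x <= b -> is_cderive x f (g x)} ->
  cint a b g = f b - f a.
Proof.
move=> ab [fr fi] [gr gi] df.
apply: complex_eqP; rewrite ?cReD ?cReN ?cImD ?cImN.
  apply: (ac_FTC ab fr gr); refine (ae_imp df _) => x fx xab.
  by have [] := fx xab.
apply: (ac_FTC ab fi gi); refine (ae_imp df _) => x fx xab.
by have [] := fx xab.
Qed.

End ComplexCalculus.

(** * Gronwall's inequality with an integrable kernel *)
Section Gronwall.
Variable R : realType.
Local Notation mu := (@lebesgue_measure R).
Implicit Types (a b x : R) (f g : R -> R).

Lemma ac_norm a b f : ac a b f -> ac a b (fun x => `|f x|).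
Proof.
move=> acf e /acf[d d0 dP]; exists d => // n u v uv no lt_d.
apply: le_lt_trans (dP n u v uv no lt_d); apply: ler_sum => i _.
exact: ler_dist_dist.
Qed.

(** The interval is crossed in steps on which the integral of g stays below 1/2.
    At a maximum point of f on such a step, half of the maximum is absorbed by
    the left-hand side.  The steps, hence the constant, depend on g only. *)
Lemma gronwall_integrable g : (forall t, 0 <= g t) ->
  mu.-integrable `[0, 1] (EFin \o g) ->
  exists2 c, 0 <= c & forall k f, 0 <= k -> ac 0 1 f ->
    (forall t, 0 <= t <= 1 -> 0 <= f t) ->
    (forall x, 0 <= x <= 1 -> f x <= k + \int[mu]_(t in `[0, x]) (f t * g t)) ->
    forall x, 0 <= x <= 1 -> f x <= c * k.
Proof.
move=> g0 intg; pose V x := \int[mu]_(t in `[0, x]) g t.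
pose P x := exists2 c, 0 <= c & forall k f, 0 <= k -> ac 0 1 f ->
    (forall t, 0 <= t <= 1 -> 0 <= f t) ->
    (forall x, 0 <= x <= 1 -> f x <= k + \int[mu]_(t in `[0, x]) (f t * g t)) ->
    forall t, 0 <= t <= x -> f t <= c * k.
suff : P 1 by [].
have h01 : 0 <= 1 :> R by [].
apply: (itv_induction h01).
  exists 1 => // k f k0 acf f0 fk t; rewrite -eq_le => /eqP <-.
  have := fk 0; rewrite set_itv1 Rintegral_set1 addr0 mul1r; apply.
  by rewrite lexx.
have half0 : 0 < 1 / 2 :> R by lra.
have [d d0 dP] := ac_modulus (ac_primitive intg) half0.
move=> y /andP[y0 y1]; exists (d / 2); first by rewrite divr_gt0.
move=> u v u0 uy yv v1 yud vyd [c c0 cP].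
have V0 : 0 <= V u by exact: Rintegral_ge0.
(* The maximum m on the new step satisfies m <= k + c k V u + m / 2. *)
exists (c + 2 * (1 + c * V u)).
  by rewrite addr_ge0// mulr_ge0// addr_ge0// mulr_ge0.
move=> k f k0 acf f0 fk.
have fc := cP k f k0 acf f0 fk.
have ck0 : 0 <= c * k by exact: mulr_ge0.
have uv : u <= v by lra.
have u1 : u <= 1 by lra.
have [z + fz] := EVT_max uv (ac_continuous (ac_sub u0 v1 acf)).
rewrite in_itv/= => /andP[uz zv].
have intfg : mu.-integrable `[0, 1] (EFin \o (fun t => f t * g t)).
  exact: ac_integrableM.
have z1 : z <= 1 by lra.
have z0 : 0 <= z by lra.
have fz0 : 0 <= f z by apply: f0; rewrite z0.
have le1 : \int[mu]_(t in `[0, u]) (f t * g t) <= c * k * V u.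
  rewrite /V -RintegralZl//; last exact: (integrable_on_sub _ _ intg).
  apply: le_Rintegral => //.
  - by apply: (integrable_on_sub _ _ intfg) => //; lra.
  - by apply: (integrable_on_sub _ _ (integrable_onZ (c * k) intg)) => //; lra.
  - move=> t /=; rewrite in_itv/= => tu; rewrite ler_wpM2r//; exact: fc.
have le2 : \int[mu]_(t in `[u, z]) (f t * g t) <= f z * (1 / 2).
  apply: (@le_trans _ _ (f z * \int[mu]_(t in `[u, z]) g t)).
    rewrite -RintegralZl//; last exact: (integrable_on_sub _ _ intg).
    apply: le_Rintegral => //.
    - exact: (integrable_on_sub _ _ intfg).
    - exact: (integrable_on_sub _ _ (integrable_onZ (f z) intg)).
    - move=> t /=; rewrite in_itv/= => /andP[ut tz]; rewrite ler_wpM2r//.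
      by apply: fz; rewrite in_itv/= ut (le_trans tz).
  rewrite ler_wpM2l//.
  have := dP u z u0 uz z1 ltac:(lra).
  rewrite [in X in X - _](Rintegral_itv_chasles u0 uz); last first.
    exact: (integrable_on_sub _ _ intg).
  rewrite addrAC subrr add0r => /ltW; apply: le_trans; exact: ler_norm.
have fzk : f z <= k + c * k * V u + f z * (1 / 2).
  apply: (le_trans (fk z _)); first by rewrite z0.
  rewrite (Rintegral_itv_chasles u0 uz); last first.
    exact: (integrable_on_sub _ _ intfg).
  by rewrite -addrA lerD2l lerD.
have kV : 0 <= c * k * V u by exact: mulr_ge0.
move=> t /andP[t0 tv]; have [tu|/ltW ut] := leP t u.
  apply: (le_trans (fc t _)); first by rewrite t0.
  by rewrite ler_wpM2r// lerDl mulr_ge0// addr_ge0// mulr_ge0.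
apply: (@le_trans _ _ (f z)); first by apply: fz; rewrite in_itv/= ut.
have -> : (c + 2 * (1 + c * V u)) * k = c * k + 2 * k + 2 *
  (c * k * V u) by ring.
lra.
Qed.

End Gronwall.

(** * The quadratic estimate for one column *)
Section SecondOrderRemainder.
Variable R : realType.
Local Notation mu := (@lebesgue_measure R).

(** In terms of w = - (b + Q), where Q is the primitive of q, the second bound
    is w x = int_0^x (Q x - Q) (Q + w) p together with Gronwall's inequality,
    and the first one is a x - 1 - int_0^x q (P x - P) = int_0^x p w. *)
Lemma remainder_quadratic (g : R -> R) : (forall t, 0 <= g t) ->
  mu.-integrable `[0, 1] (EFin \o g) ->
  exists2 c, 0 <= c & forall (p q a b : R -> R[i]) (k : R),
    cintegrable `[0, 1] p -> cintegrable `[0, 1] q ->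
    (forall t, 0 <= t <= 1 -> cmod (p t) <= g t) ->
    (forall t, 0 <= t <= 1 -> cmod (q t) <= g t) ->
    cac 0 1 a -> cac 0 1 b -> a 0 = 1 -> b 0 = 0 ->
    {ae mu, forall x, 0 <= x <= 1 ->
      is_cderive x a (- (p x * b x)) /\ is_cderive x b (- (q x * a x))} ->
    (forall x, 0 <= x <= 1 -> cmod (cint 0 x q) <= k) ->
    forall x, 0 <= x <= 1 ->
      cmod (a x - 1 - cint 0 x (fun t => (cint 0 x p - cint 0 t p) * q t))
        <= c * k ^+ 2 /\
      cmod (b x + cint 0 x q) <= c * k ^+ 2.
Proof.
move=> g0 intg; pose V := \int[mu]_(t in `[0, 1]) g t.
have V0 : 0 <= V by exact: Rintegral_ge0.
have gV x : 0 <= x <= 1 -> \int[mu]_(t in `[0, x]) g t <= V.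
  move=> /andP[x0 x1]; rewrite /V (Rintegral_itv_chasles x0 x1 intg) lerDl.
  exact: Rintegral_ge0.
(* The kernel comes from |Q x - Q| <= 4 V: one factor 2 is lost in
   cmod_cint_le, another one in passing from cmod w to f below. *)
have [c c0 gron] : exists2 c, 0 <= c & forall k f, 0 <= k -> ac 0 1 f ->
    (forall t, 0 <= t <= 1 -> 0 <= f t) ->
    (forall x, 0 <= x <= 1 ->
       f x <= k + \int[mu]_(t in `[0, x]) (f t * (16 * V * g t))) ->
    forall x, 0 <= x <= 1 -> f x <= c * k.
  apply: gronwall_integrable; last exact: integrable_onZ.
  by move=> t; rewrite !mulr_ge0.
exists (c * (8 * V) + 2 * (c * (8 * V)) * V).
  by rewrite addr_ge0// !mulr_ge0.
move=> p q a b k intp intq pg qg caca cacb a0 b0 dab qk.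
pose P x := cint 0 x p; pose Q x := cint 0 x q.
have cacP : cac 0 1 P by exact: cac_primitive.
have cacQ : cac 0 1 Q by exact: cac_primitive.
pose w x := - (b x + Q x).
have cacw : cac 0 1 w by apply: cacN; exact: cacD.
have Q0 : Q 0 = 0 by exact: cint_pt.
have P0 : P 0 = 0 by exact: cint_pt.
have w0 : w 0 = 0 by rewrite /w b0 Q0 addr0 oppr0.
have k0 : 0 <= k.
  by apply: (le_trans (cmod_ge0 _) (qk 0 _)); rewrite lexx ler01.
have dall : {ae mu, forall t, 0 <= t <= 1 ->
    [/\ is_cderive t a (p t * (Q t + w t)), is_cderive t w (q t * (a t - 1)),
        is_cderive t P (p t) & is_cderive t Q (q t)]}.
  refine (ae_imp2 dab (ae_imp2 (cprimitive_derive intp) (cprimitive_derive intq)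
     (fun x => @conj _ _)) _).
  move=> t + [+ +] t01 => /(_ t01)[da db] /(_ t01) dp /(_ t01) dq.
  split => //; first by apply: is_cderive_eq da _; rewrite /w; ring.
  apply: is_cderive_eq (is_cderiveN (is_cderiveD db dq)) _; ring.
(* The function (Q x - Q t) (a t - 1) + w t vanishes at 0, equals w x at x, and
   the terms q (a t - 1) cancel in its derivative. *)
have wE x : 0 <= x <= 1 ->
    w x = cint 0 x (fun t => (Q x - Q t) * (Q t + w t) * p t).
  move=> /andP[x0 x1].
  have cac1 f : cac 0 1 f -> cac 0 x f by exact: cac_sub.
  rewrite (@cac_FTC _ 0 x (fun t => (Q x - Q t) * (a t - 1) + w t))//.
  - by rewrite subrr mul0r add0r a0 subrr mulr0 w0 add0r subr0.
  - apply: cac1; apply: cacD => //; apply: cacM; apply: cacB => //;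
    exact: cac_cst.
  - apply: cac_cintegrableM; last exact: cintegrable_sub intp.
    apply: cac1; apply: cacM; [apply: cacB => //; exact: cac_cst|exact: cacD].
  - refine (ae_imp dall _) => t dt /andP[t0 tx].
    have [da dw dp dq] := dt ltac:(by rewrite t0 (le_trans tx)).
    apply: is_cderive_eq (is_cderiveD (is_cderiveM (is_cderiveB
      (is_cderive_cst _ _) dq)
       (is_cderiveB da (is_cderive_cst _ _))) dw) _.
    ring.
pose f x := `|Re (w x)| + `|Im (w x)|.
have acf : ac 0 1 f by apply: acD; apply: ac_norm;
  [exact: cacw.1|exact: cacw.2].
have QV x : 0 <= x <= 1 -> cmod (Q x) <= 2 * V.
  move=> /[dup] x01 /andP[x0 x1];
    apply: (le_trans (cmod_cint_le (g := g) _ _ _)).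
  - exact: cintegrable_sub intq.
  - exact: integrable_on_sub intg.
  - by move=> t /andP[t0 tx]; apply: qg; rewrite t0 (le_trans tx).
  - by rewrite ler_wpM2l// gV.
have wf x : cmod (w x) <= f x by exact: cmod_le_parts.
have fle x : 0 <= x <= 1 -> f x <= c * (8 * V) * k ^+ 2.
  rewrite -mulrA; apply: gron => //.
  - by rewrite !mulr_ge0// exprn_ge0.
  - by move=> t _; rewrite addr_ge0.
  move=> {}x /[dup] x01 /andP[x0 x1].
  apply: (@le_trans _ _ (2 * cmod (w x))).
    by rewrite mulr2n mulrDl mul1r lerD// (normr_Re_le, normr_Im_le).
  rewrite wE//.
  have intfg : mu.-integrable `[0, 1] (EFin \o (fun t => f t * (16 * V * g t))).
    by apply: ac_integrableM => //; exact: integrable_onZ.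
  have subI h : mu.-integrable `[0, 1] (EFin \o h) ->
      mu.-integrable `[0, x] (EFin \o h) by exact: integrable_on_sub.
  have intG : mu.-integrable `[0, x]
      (EFin \o (fun t => 2 * k ^+ 2 * g t + 4^-1 * (f t * (16 * V * g t)))).
    have := integrableD _ (subI _ (integrable_onZ (2 * k ^+ 2) intg)) (subI _
      (integrable_onZ 4^-1 intfg)).
    by move=> /(_ (measurable_itv _)); apply: eq_integrable.
  apply: (@le_trans _ _ (2 * (2 * \int[mu]_(t in `[0, x])
      (2 * k ^+ 2 * g t + 4^-1 * (f t * (16 * V * g t)))))).
    rewrite ler_wpM2l//; apply: cmod_cint_le => //.
      apply: (cintegrable_sub (lexx 0) x1).
      apply: cac_cintegrableM => //; apply: cacM; [apply: cacB => //;
        exact: cac_cst|exact: cacD].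
    move=> t /andP[t0 tx]; have t01 : 0 <= t <= 1 by rewrite t0 (le_trans tx).
    have kx := qk x x01; have kt := qk t t01.
    have Vx := QV x x01; have Vt := QV t t01.
    have f0 : 0 <= f t by rewrite addr_ge0.
    rewrite mulrDr mulrDl (le_trans (cmodD _ _))// !cmodM; apply: lerD.
      apply: ler_pM; rewrite ?mulr_ge0 ?cmod_ge0//; last exact: pg.
      rewrite expr2 mulrA; apply: ler_pM; rewrite ?cmod_ge0//.
      by rewrite (le_trans (cmodB _ _))// mulr2n mulrDl mul1r lerD.
    rewrite [leRHS](_ : _ = 4 * V * f t * g t); last by field.
    apply: ler_pM; rewrite ?mulr_ge0 ?cmod_ge0//; last exact: pg.
    apply: ler_pM; rewrite ?cmod_ge0//.
    by rewrite (le_trans (cmodB _ _))// (_ : 4 * V = 2 * V + 2 * V) ?lerD//;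
      ring.
  rewrite RintegralD//; [|exact: subI (integrable_onZ _ intg)|exact: subI
    (integrable_onZ _ intfg)].
  rewrite RintegralZl//; last exact: subI.
  rewrite RintegralZl//; last exact: subI.
  rewrite [leLHS](_ : _ = 8 * k ^+ 2 * \int[mu]_(t in `[0, x]) g t +
     \int[mu]_(t in `[0, x]) (f t * (16 * V * g t))); last by field.
  rewrite lerD2r [leRHS](_ : _ = 8 * k ^+ 2 * V); last by ring.
  by rewrite ler_wpM2l ?gV// mulr_ge0// exprn_ge0.
have C0 : 0 <= c * (8 * V) by rewrite !mulr_ge0.
move=> x /[dup] x01 /andP[x0 x1]; split; last first.
  rewrite -cmodN -/(Q x) -/(w x) (le_trans (wf x))// (le_trans (fle x x01))//.
  by rewrite ler_wpM2r ?exprn_ge0// lerDl !mulr_ge0.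
have cac1 f' : cac 0 1 f' -> cac 0 x f' by exact: cac_sub.
have cacPx : cac 0 x (fun t => P x - P t).
  by apply: cac1; apply: cacB => //; exact: cac_cst.
have intp' := cintegrable_sub (lexx 0) x1 intp.
have intq' := cintegrable_sub (lexx 0) x1 intq.
(* The function a t - 1 + (P x - P t) Q t vanishes at 0, equals a x - 1 at x,
   and has the derivative w p + (P x - P) q. *)
have -> : a x - 1 - cint 0 x (fun t => (P x - P t) * q t) =
    cint 0 x (fun t => w t * p t).
  apply/eqP; rewrite subr_eq -cintD; last 2 first.
    by apply: cac_cintegrableM => //; exact: cac1.
    exact: cac_cintegrableM.
  rewrite (@cac_FTC _ 0 x (fun t => (a t - 1) + (P x - P t) * Q t))//.
  - by rewrite subrr mul0r addr0 a0 subrr add0r Q0 mulr0 subr0.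
  - apply: cacD; last by apply: cacM => //; exact: cac1.
    by apply: cac1; apply: cacB => //; exact: cac_cst.
  - by apply: cintegrableD; apply: cac_cintegrableM => //; exact: cac1.
  - refine (ae_imp dall _) => t dt /andP[t0 tx].
    have [da dw dp dq] := dt ltac:(by rewrite t0 (le_trans tx)).
    apply: is_cderive_eq (is_cderiveD (is_cderiveB da (is_cderive_cst _ _))
      (is_cderiveM (is_cderiveB (is_cderive_cst _ _) dp) dq)) _.
    ring.
have cintwp : cintegrable `[0, x] (fun t => w t * p t).
  by apply: cac_cintegrableM => //; exact: cac1.
apply: (le_trans (cmod_cint_le cintwp
   (integrable_on_sub (lexx 0) x1 (integrable_onZ (c *
     (8 * V) * k ^+ 2) intg)) _)).
  move=> t /andP[t0 tx]; have t01 : 0 <= t <= 1 by rewrite t0 (le_trans tx).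
  rewrite cmodM; apply: ler_pM; rewrite ?cmod_ge0 ?pg//.
  by rewrite (le_trans (wf t))// fle.
rewrite RintegralZl//; last exact: (integrable_on_sub (lexx 0) x1).
rewrite [leRHS](_ : _ = c * (8 * V) * k ^+ 2 + 2 * (c * (8 * V) * k ^+ 2 * V));
  last by ring.
apply: ler_wpDl; first by rewrite mulr_ge0// exprn_ge0.
by rewrite !ler_wpM2l ?gV// mulr_ge0// exprn_ge0.
Qed.

End SecondOrderRemainder.

(** * The exponential of a diagonal matrix *)
Section ComplexExponential.
Local Open Scope complex_scope.
Variable R : realType.
Implicit Types (z w c : R[i]) (a b t : R).

Lemma cexpD z w : cexp (z + w) = cexp z * cexp w.
Proof.
rewrite /cexp cReD cImD expRD cosD sinD; apply: complex_eqP;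
  rewrite ?cReM ?cImM/=; ring.
Qed.

Lemma cexp0 : cexp 0 = 1 :> R[i].
Proof. by apply: complex_eqP; rewrite /= expR0 ?cos0 ?sin0 ?mulr1 ?mulr0. Qed.

Lemma cexpNK z : cexp (- z) * cexp z = 1.
Proof. by rewrite -cexpD addNr cexp0. Qed.

Lemma cmod_cexp z : cmod (cexp z) = expR (Re z).
Proof.
rewrite /= !exprMn -mulrDr cos2Dsin2 mulr1 sqrtr_sqr ger0_norm//;
  exact: expR_ge0.
Qed.

Lemma Re_mulrC c t : Re (c * t%:C) = Re c * t.
Proof. by rewrite cReM /= mulr0 subr0. Qed.

Lemma Im_mulrC c t : Im (c * t%:C) = Im c * t.
Proof. by rewrite cImM /= mulr0 add0r. Qed.

Lemma is_derive_scale (k x : R) (u : R ->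
  R) (l : R) : is_derive (k * x) 1 u l ->
  is_derive x 1 (fun t => u (k * t)) (k * l).
Proof.
move=> du; have dk : is_derive x 1 (fun t => k * t) k.
  apply: (is_derive_ext (is_deriveM (is_derive_cst k x 1)
    (is_derive_id x 1))) => //.
  by rewrite /GRing.scale/= mulr1 mulr0 addr0.
by apply: (is_derive_ext (is_derive1_comp du dk)) => //; rewrite mulrC.
Qed.

Lemma is_cderive_cexp c x :
  is_cderive x (fun t => cexp (c * t%:C)) (c * cexp (c * x%:C)).
Proof.
have de := is_derive_scale (is_derive_expR (Re c * x)).
have ds := is_derive_scale (is_derive_sin (Im c * x)).
have dc := is_derive_scale (is_derive_cos (Im c * x)).
split.
  apply: (is_derive_ext (is_deriveM de dc)) => [t|].
    by rewrite /= Re_mulrC Im_mulrC.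
  by rewrite cReM /= Re_mulrC Im_mulrC /GRing.scale/=; ring.
apply: (is_derive_ext (is_deriveM de ds)) => [t|].
  by rewrite /= Re_mulrC Im_mulrC.
by rewrite cImM /= Re_mulrC Im_mulrC /GRing.scale/=; ring.
Qed.

Lemma C1_ac a b (u v : R -> R) : (forall x : R, is_derive x 1 u (v x)) ->
  continuous v -> ac a b u.
Proof.
move=> du cv; have cu : continuous u.
  move=> x; apply: differentiable_continuous; apply/derivable1_diffP.
  exact: (@ex_derive _ _ _ _ _ _ _ (du x)).
have [k k0 vk] := within_continuous_bounded (continuous_subspaceT
  (A := `[a, b]) cv).
apply: (@ac_lipschitz _ a b k) => x y ax xy yb.
have [z + ->] := MVT_segment xy (fun s _ => du s) (continuous_subspaceT cu).
rewrite in_itv/= => /andP[xz zy];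
  rewrite normrM (ger0_norm (_ : 0 <= y - x)) ?subr_ge0//.
by rewrite ler_wpM2r ?subr_ge0// vk// (le_trans ax)//= (le_trans zy).
Qed.

Lemma cac_cexp a b c : cac a b (fun t => cexp (c * t%:C)).
Proof.
have cmul (k l : R) (u : R -> R) : continuous u ->
  continuous (fun t => k * u (l * t)).
  move=> cu t; apply: cvgM; first exact: cvg_cst.
  apply: (continuous_comp (g := u)); last exact: cu.
  by apply: cvgM; [exact: cvg_cst|exact: cvg_id].
have ae : ac a b (fun t => expR (Re c * t)).
  apply: (@C1_ac _ _ _ (fun t => Re c * expR (Re c * t))) => [x|].
    exact: is_derive_scale.
  exact/cmul/continuous_expR.
have as_ : ac a b (fun t => sin (Im c * t)).
  apply: (@C1_ac _ _ _ (fun t => Im c * cos (Im c * t))) => [x|].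
    exact: is_derive_scale.
  exact/cmul/continuous_cos.
have ac_ : ac a b (fun t => cos (Im c * t)).
  apply: (@C1_ac _ _ _ (fun t => Im c * - sin (Im c * t))) => [x|].
    exact: is_derive_scale.
  apply: (cmul (Im c) (Im c) (fun x => - sin x)) => t; apply: cvgN;
    exact: continuous_sin.
split.
  by apply: ac_ext (acM ae ac_) => t _; rewrite /= Re_mulrC Im_mulrC.
by apply: ac_ext (acM ae as_) => t _; rewrite /= Re_mulrC Im_mulrC.
Qed.

(* power series *)

Lemma is_cvg_pseries_factorial (u : nat -> R) (m r x : R) : 0 <= r -> 0 <= m ->
  (forall n, `|u n| <= m * r ^+ n / n`!%:R) -> cvgn (pseries u x).
Proof.
move=> r0 m0 um; apply: normed_cvg.
apply: (@series_le_cvg _ _ (m *: exp_coeff (r * `|x|))).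
- by move=> n; exact: normr_ge0.
- by move=> n; rewrite /= mulr_ge0// divr_ge0// exprn_ge0// mulr_ge0.
- move=> n; change (`|u n * x ^+ n| <= m * ((r * `|x|) ^+ n / n`!%:R)).
  rewrite normrM normrX exprMn.
  rewrite [leRHS](_ : _ = m * r ^+ n / n`!%:R * `|x| ^+ n); last first.
    by ring.
  by rewrite ler_wpM2r// exprn_ge0.
exact/is_cvg_seriesZ/is_cvg_series_exp_coeff.
Qed.

Lemma cmodX z n : cmod (z ^+ n) = cmod z ^+ n.
Proof.
elim: n => [|n IH]; first by rewrite !expr0; exact: ComplexField.Normc.normc1.
by rewrite !exprS cmodM IH.
Qed.

(** The coefficients of the iterated derivatives of the real and imaginary parts
    of t |-> e^(t z), written as power series in t. *)
Lemma is_cvg_pseries_shift z k x :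
  cvgn (pseries (fun n => Re (z ^+ (n + k)) / n`!%:R) x) /\
  cvgn (pseries (fun n => Im (z ^+ (n + k)) / n`!%:R) x).
Proof.
have le_n n : cmod (z ^+ (n + k)) = cmod z ^+ k * cmod z ^+ n.
  by rewrite cmodX exprD mulrC.
by split; apply: (@is_cvg_pseries_factorial _ (cmod z ^+ k) (cmod z));
  rewrite ?exprn_ge0 ?cmod_ge0// => n;
    rewrite normrM normfV [`|_%:R|]ger0_norm//;
  rewrite ler_wpM2r// -le_n (normr_Re_le, normr_Im_le).
Qed.

Lemma pseries_diffs_shift (f : nat -> R) k :
  pseries_diffs (fun n => f (n + k)%N / n`!%:R) = (fun n =>
    f (n + k.+1)%N / n`!%:R).
Proof.
apply/funext => n; rewrite /pseries_diffs factS natrM invfM addnS addSn.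
by rewrite mulrCA !mulrA mulfK ?pnatr_eq0.
Qed.

Lemma is_derive_pseries_shift z (f : nat -> R) (x : R) :
  (f = fun n => Re (z ^+ n)) \/ (f = fun n => Im (z ^+ n)) ->
  is_derive x 1 (fun y : R => limn (pseries (fun n => f (n + 0)%N / n`!%:R) y))
    (limn (pseries (fun n => f (n + 1)%N / n`!%:R) x)).
Proof.
move=> fz.
have cf k y : cvgn (pseries (fun n => f (n + k)%N / n`!%:R) y).
  by case: fz => ->; have [] := is_cvg_pseries_shift z k y.
rewrite -pseries_diffs_shift; apply: (@pseries_snd_diffs _ _ (`|x| + 1)).
- exact: cf.
- by rewrite pseries_diffs_shift; exact: cf.
- by rewrite !pseries_diffs_shift; exact: cf.
- by rewrite [ltRHS]ger0_norm ?ltrDl// addr_ge0.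
Qed.

(** As a function of t, the series e t at t z solves e' = z e with e 0 = 1.
    Hence e t * cexp (- z t) is constant. *)
Lemma cexp_series z : clim (fun n =>
  \sum_(k < n) (k`!%:R^-1 * z ^+ k)) = cexp z.
Proof.
pose re t := limn (pseries (fun n => Re (z ^+ (n + 0)) / n`!%:R) t).
pose im t := limn (pseries (fun n => Im (z ^+ (n + 0)) / n`!%:R) t).
pose e t : R[i] := re t +i* im t.
have dre (t : R) : is_derive t 1 re (limn (pseries (fun n =>
  Re (z ^+ (n + 1)) / n`!%:R) t)).
  by apply: (@is_derive_pseries_shift z (fun n => Re (z ^+ n))); left.
have dim (t : R) : is_derive t 1 im (limn (pseries (fun n =>
  Im (z ^+ (n + 1)) / n`!%:R) t)).
  by apply: (@is_derive_pseries_shift z (fun n => Im (z ^+ n))); right.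
have c0 t := is_cvg_pseries_shift z 0 t.
have lin (k l : R) (u v : nat -> R) (t : R) :
    cvgn (pseries u t) -> cvgn (pseries v t) ->
    limn (pseries (fun n => k * u n + l * v n) t) =
    k * limn (pseries u t) + l * limn (pseries v t).
  move=> cu cv; apply: (@cvg_lim _ (@Rhausdorff R)).
  have -> : pseries (fun n => k * u n + l * v n) t =
      (fun n => k * pseries u t n + l * pseries v t n).
    apply/funext => n; rewrite /pseries /series /= !mulr_sumr -big_split/=.
    by apply: eq_bigr => i _; ring.
  by apply: cvgD; (apply: cvgM; [exact: cvg_cst|]).
have de t : is_cderive t e (z * e t).
  have [cr ci] := c0 t; split.
    apply: (is_derive_ext (dre t)) => //; rewrite cReM -mulNr -lin//.
    congr (limn (pseries _ t)); apply/funext => n.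
    by rewrite addn1 addn0 exprS cReM; ring.
  apply: (is_derive_ext (dim t)) => //; rewrite cImM -lin//.
  congr (limn (pseries _ t)); apply/funext => n.
  by rewrite addn1 addn0 exprS cImM; ring.
have dh t : is_cderive t (fun t => e t * cexp (- z * t%:C)) 0.
  apply: is_cderive_eq (is_cderiveM (de t) (is_cderive_cexp (- z) t)) _; ring.
have h10 : e 1 * cexp (- z * 1%:C) = e 0 * cexp (- z * 0%:C).
  apply: complex_eqP.
    exact: (is_derive_0_is_cst 1 0 (fun t => (dh t).1)).
  exact: (is_derive_0_is_cst 1 0 (fun t => (dh t).2)).
have pseries0 (u : nat -> R) : limn (pseries u 0) = u 0%N.
  apply: (@cvg_lim _ (@Rhausdorff R)); rewrite -(cvg_shiftn 1).
  apply: cvg_near_cst; apply: nearW => n.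
  rewrite /pseries/series/= addn1 big_nat_recl//= expr0 mulr1 big1 ?addr0// =>
    i _.
  by rewrite expr0n mulr0.
have e0 : e 0 = 1.
  by apply: complex_eqP; rewrite /= /re /im pseries0 fact0 divr1.
have e1 : e 1 = cexp z.
  move: h10; rewrite e0 mul1r mulr0 mulr1 cexp0 => /(congr1 (fun y =>
    y * cexp z)).
  by rewrite -mulrA cexpNK mulr1 mul1r.
have natV m : m%:R^-1 = (m%:R^-1 : R)%:C by rewrite fmorphV rmorph_nat.
rewrite -e1; apply: complex_eqP; rewrite /= /re /im; congr (limn _);
  apply/funext => n; rewrite /pseries /series /= big_mkord.
  elim/big_ind2 : _ => // [_ x _ y <- <-|k _]; first by rewrite cReD.
  by rewrite natV mulrC Re_mulrC expr1n mulr1 addn0.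
elim/big_ind2 : _ => // [_ x _ y <- <-|k _]; first by rewrite cImD.
by rewrite natV mulrC Im_mulrC expr1n mulr1 addn0.
Qed.

Lemma mx22M (a b c d a' b' c' d' : R[i]) :
  mx22 a b c d *m mx22 a' b' c' d' =
  mx22 (a * a' + b * c') (a * b' + b * d') (c * a' + d * c') (c * b' + d * d').
Proof.
apply/matrixP => i j; rewrite !mxE big_ord_recl big_ord1 !mxE.
by case: ifPn => _; case: ifPn.
Qed.

Lemma mxexp_J0 z : mxexp (z *: J0 R) = mx22 (cexp z) 0 0 (cexp (- z)).
Proof.
have JX k : (z *: J0 R) ^+ k = mx22 (z ^+ k) 0 0 ((- z) ^+ k).
  elim: k => [|k IH].
    rewrite !expr0; apply/matrixP => i j; rewrite !mxE.
    by case: i j => [[|[|//]]] ? [[|[|//]]] ?.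
  rewrite exprS IH /J0; have -> : z *: mx22 1 0 0 (- 1) = mx22 z 0 0 (- z).
    apply/matrixP => i j; rewrite !mxE.
    by case: ifPn => _; case: ifPn => _; rewrite ?mulr1 ?mulr0 ?mulrN1.
  by rewrite -[LHS]/(_ *m _) mx22M !mul0r !mulr0 !addr0 !add0r -!exprS.
have clim0 : clim (fun=> 0) = 0 :> R[i].
  by apply: complex_eqP; rewrite /= lim_cst.
apply/matrixP => i j; rewrite !mxE.
transitivity (clim (fun n => \sum_(k < n)
    (k`!%:R^-1 * (mx22 (z ^+ k) 0 0 ((- z) ^+ k) i j)))).
  by congr clim; apply/funext => n; rewrite summxE; apply: eq_bigr => k _;
    rewrite JX !mxE.
have sum0 : clim (fun n => \sum_(k < n) (k`!%:R^-1 * 0)) = 0 :> R[i].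
  by rewrite -[RHS]clim0; congr clim; apply/funext => n; rewrite big1// => k _;
    rewrite mulr0.
rewrite -2!cexp_series.
have [i0|i0] := boolP (i == 0); have [j0|j0] := boolP (j == 0).
- by congr clim; apply/funext => n; apply: eq_bigr => k _; rewrite !mxE i0 j0.
- rewrite -[RHS]sum0; congr clim.
  by apply/funext => n; apply: eq_bigr => k _; rewrite !mxE i0 (negbTE j0).
- rewrite -[RHS]sum0; congr clim.
  by apply/funext => n; apply: eq_bigr => k _; rewrite !mxE j0 (negbTE i0).
- by congr clim; apply/funext => n; apply: eq_bigr => k _;
  rewrite !mxE (negbTE i0) (negbTE j0).
Qed.

End ComplexExponential.

(** * Fubini's theorem on a sheared triangle *)
Section Translation.
Variable R : realType.
Local Notation mu := (@lebesgue_measure R).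

Lemma measurable_shift (c : R) :
  @measurable_fun _ _ (measurableTypeR R) (measurableTypeR R) setT (+%R^~ c).
Proof. by apply: measurable_funD => //; exact: measurable_cst. Qed.

Lemma lebesgue_measure_shift (c : R) (A : set R) : measurable A ->
  @pushforward _ _ (measurableTypeR R) (measurableTypeR R) R mu
    (+%R^~ c) A = mu A.
Proof.
pose sh : {mfun measurableTypeR R >-> measurableTypeR R} :=
  HB.pack (+%R^~ c : measurableTypeR R -> measurableTypeR R)
    (isMeasurableFun.Build _ _ _ _ _ (measurable_shift c)).
move=> mA; apply/esym;
  rewrite -[LHS]/(lebesgue_measure A) -[RHS]/(pushforward mu sh A).
apply: lebesgue_measure_unique => //= _ [[a b]] _ <-.
rewrite -[LHS]/(mu `]a, b]%classic) /pushforward.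
rewrite (_ : _ @^-1` _ = `](a - c), (b - c)]%classic); last first.
  by apply/seteqP; split => t /=; rewrite !in_itv/= ltrBlDr lerBrDr.
rewrite -[RHS]/(mu `]a - c, b - c]%classic).
rewrite !lebesgue_measure_itv/= !lte_fin ltrD2r; case: ifP => // _.
by rewrite -!EFinB; congr EFin; ring.
Qed.

Lemma ge0_integral_shift (c : R) (h : R -> \bar R) : measurable_fun setT h ->
  (forall t, (0 <= h t)%E) -> (\int[mu]_t h (t + c)%R = \int[mu]_t h t)%E.
Proof.
move=> mh h0.
have := @ge0_integral_pushforward _ _ (measurableTypeR R)
  (measurableTypeR R) R _ (measurable_shift c) mu setT h measurableT mh.
rewrite preimage_setT => <- => [|t _]; last exact: h0.
apply: eq_measure_integral => [|mf A mA _]; first exact: measurable_shift.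
exact: lebesgue_measure_shift.
Qed.

Lemma integral_shift (c : R) (h : R -> \bar R) : measurable_fun setT h ->
  (\int[mu]_t h (t + c)%R = \int[mu]_t h t)%E.
Proof.
move=> mh; rewrite [in LHS]integralE [in RHS]integralE.
rewrite -(ge0_integral_shift c (measurable_funepos mh) (funepos_ge0 h)).
rewrite -(ge0_integral_shift c (measurable_funeneg mh) (funeneg_ge0 h)).
by congr (adde _ (oppe _)); apply: eq_integral => t _;
  rewrite !(funeposE, funenegE).
Qed.

End Translation.

Section FubiniShear.
Variable R : realType.
Local Notation mu := (@lebesgue_measure R).
Local Notation mu2 := (mu \x mu)%E.
Implicit Types (e u v : R -> R) (G : R * R -> R).

Lemma Rintegral_fubini_measurable G : mu2.-integrable setT (EFin \o G) ->
  measurable_fun setT (fun t => \int[mu]_s G (t, s)).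
Proof.
move=> intG; apply: (measurableT_comp (f := fine)) => //.
exact: (measurable_fubini_F intG).
Qed.

Lemma Rintegral_fubini_measurableG G : mu2.-integrable setT (EFin \o G) ->
  measurable_fun setT (fun s => \int[mu]_t G (t, s)).
Proof.
move=> intG; apply: (measurableT_comp (f := fine)) => //.
exact: (measurable_fubini_G intG).
Qed.

(** The inner integrals are finite only almost everywhere, while [Rintegral]
    turns an infinite one into 0; this only concerns a null set. *)
Lemma Rfubini G : mu2.-integrable setT (EFin \o G) ->
  \int[mu]_t \int[mu]_s G (t, s) = \int[mu]_s \int[mu]_t G (t, s).
Proof.
move=> intG; rewrite /Rintegral; congr fine.
transitivity (\int[mu]_t \int[mu]_s (G (t, s))%:E)%E.
  apply: ae_eq_integral => //.
  - by apply/measurable_EFinP; exact: Rintegral_fubini_measurable intG.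
  - exact: (measurable_fubini_F intG).
  - refine (ae_imp (ae_integrable1 intG) _) => t intt _.
    by rewrite /= fineK//; exact: integrable_fin_num.
rewrite (Fubini intG).
apply: ae_eq_integral => //.
- exact: (measurable_fubini_G intG).
- by apply/measurable_EFinP; exact: Rintegral_fubini_measurableG intG.
- refine (ae_imp (ae_integrable2 intG) _) => t intt _.
  by rewrite /= fineK//; exact: integrable_fin_num.
Qed.

Lemma measurable_mul_shear u v : measurable_fun setT u ->
  measurable_fun setT v ->
  measurable_fun setT (fun z : R * R => u (z.1 + z.2) * v z.2).
Proof.
move=> mu_ mv; apply: measurable_funM;
  last exact: measurableT_comp mv measurable_snd.
by apply: measurableT_comp mu_ _; apply: measurable_funD;
  [exact: measurable_fst|exact: measurable_snd].
Qed.

(** By Tonelli's theorem and translation invariance, the integral of the modulus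
    is the product of the norms of u and v. *)
Lemma integrable_mul_shear u v : mu.-integrable setT (EFin \o u) ->
  mu.-integrable setT (EFin \o v) ->
  mu2.-integrable setT (EFin \o (fun z => u (z.1 + z.2) * v z.2)).
Proof.
move=> intu intv.
have mu_ : measurable_fun setT u.
  apply/measurable_EFinP.
  exact: (measurable_int mu).
have mv : measurable_fun setT v by apply/measurable_EFinP;
  exact: (measurable_int mu).
have m2 := measurable_mul_shear mu_ mv.
apply/integrable21ltyP; first exact/measurable_EFinP.
have intU : (\int[mu]_t `|(u t)%:E| < +oo)%E by case/integrableP : intu.
pose c := fine (\int[mu]_t `|(u t)%:E|)%E.
have cE : (\int[mu]_t `|(u t)%:E|)%E = c%:E.
  by rewrite /c fineK// ge0_fin_numE//; exact: integral_ge0.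
rewrite (_ : (\int[mu]_y _)%E = (\int[mu]_y (c%:E * `|(v y)%:E|))%E);
  last first.
  apply: eq_integral => y _ /=.
  under eq_integral do rewrite normrM EFinM.
  rewrite ge0_integralZr//.
    have -> : (\int[mu]_x `|u (x + y)|%:E = \int[mu]_x `|u x|%:E)%E.
      apply: (ge0_integral_shift y (h := fun t => `|u t|%:E)) => //.
      by apply/measurable_EFinP; apply: measurableT_comp.
    by rewrite [X in (X * _)%E]cE.
  apply/measurable_EFinP; apply: measurableT_comp => //.
  exact: measurableT_comp mu_ (measurable_shift y).
rewrite ge0_integralZl//.
- by rewrite lte_mul_pinfty//;
  [rewrite lee_fin fine_ge0// integral_ge0|case/integrableP : intv].
- by apply/measurable_EFinP; exact: measurableT_comp.
- by rewrite lee_fin fine_ge0// integral_ge0.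
Qed.

Lemma integrable_bounded_mul (e : R -> R) (k : R) G : measurable_fun setT e ->
  (forall t, `|e t| <= k) -> mu2.-integrable setT (EFin \o G) ->
  mu2.-integrable setT (EFin \o (fun z => e z.1 * G z)).
Proof.
move=> me ek intG; apply: (integrableMr _ _ _ intG) => //.
  exact: measurableT_comp me measurable_fst.
exists k; split; first exact: num_real.
by move=> M kM z _ /=; exact: le_trans (ek _) (ltW kM).
Qed.

End FubiniShear.

Section ComplexFubini.
Local Open Scope complex_scope.
Variable R : realType.
Local Notation mu := (@lebesgue_measure R).
Local Notation mu2 := (mu \x mu)%E.
Implicit Types (e f g : R -> R[i]) (F : R -> R -> R[i]).

Definition cintT f : R[i] := (\int[mu]_t Re (f t)) +i* (\int[mu]_t Im (f t)).

Definition cmeasurable d (T : measurableType d) (f : T -> R[i]) :=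
  measurable_fun setT (fun t => Re (f t)) /\
    measurable_fun setT (fun t => Im (f t)).

Definition cintegrable2 F :=
  mu2.-integrable setT (fun z => (Re (F z.1 z.2))%:E) /\
  mu2.-integrable setT (fun z => (Im (F z.1 z.2))%:E).

Lemma cmeasurableM d (T : measurableType d) (f g : T -> R[i]) :
  cmeasurable f -> cmeasurable g -> cmeasurable (fun t => f t * g t).
Proof.
move=> [fr fi] [gr gi]; split.
  apply: (eq_measurable_fun (fun t =>
    Re (f t) * Re (g t) - Im (f t) * Im (g t))).
    by move=> t _; rewrite cReM.
  by apply: measurable_funB; exact: measurable_funM.
apply: (eq_measurable_fun (fun t => Re (f t) * Im (g t) + Im (f t) * Re (g t))).
  by move=> t _; rewrite cImM.
by apply: measurable_funD; exact: measurable_funM.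
Qed.

Lemma cintegrable_cmeasurable f : cintegrable setT f -> cmeasurable f.
Proof.
by move=> [fr fi]; split; apply/measurable_EFinP;
  [exact: (measurable_int mu fr)|exact: (measurable_int mu fi)].
Qed.

Lemma cmeasurable_shift f c : cmeasurable f ->
  cmeasurable (fun t : R => f (t + c)).
Proof.
by move=> [fr fi]; split; [apply: measurableT_comp fr (measurable_shift c)|
  apply: measurableT_comp fi (measurable_shift c)].
Qed.

Lemma eq_cintT f g : f =1 g -> cintT f = cintT g.
Proof. by move=> /funext ->. Qed.

Lemma cint_cintT a b f :
  cint a b f = cintT (fun t => if a <= t <= b then f t else 0).
Proof.
apply: complex_eqP => /=; rewrite Rintegral_mkcond; congr Rintegral;
  by apply/funext => t; rewrite patchE mem_setE /= in_itv/=; case: ifP.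
Qed.

Lemma cintegrable_mkcond a b f : cintegrable `[a, b] f ->
  cintegrable setT (fun t => if a <= t <= b then f t else 0).
Proof.
move=> [fr fi].
have mI : measurable (`[a, b]%classic : set (measurableTypeR R)) by [].
split.
  apply: eq_integrable ((integrable_mkcond _ mI).1 fr) => //= t _.
  by rewrite patchE mem_setE /= in_itv/=; case: ifP.
apply: eq_integrable ((integrable_mkcond _ mI).1 fi) => //= t _.
by rewrite patchE mem_setE /= in_itv/=; case: ifP.
Qed.

Lemma cintT_shift f c : cmeasurable f -> cintT (fun t => f (t + c)) = cintT f.
Proof.
move=> [fr fi]; apply: complex_eqP => /=; rewrite /Rintegral; congr fine.
  apply: (integral_shift c (h := fun t => (Re (f t))%:E)).
  exact/measurable_EFinP.
apply: (integral_shift c (h := fun t => (Im (f t))%:E)).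
exact/measurable_EFinP.
Qed.

Lemma cintTZ (k : R[i]) f : cintegrable setT f ->
  cintT (fun t => k * f t) = k * cintT f.
Proof.
move=> [fr fi].
have Z r (u : R -> R) : mu.-integrable setT (EFin \o u) ->
    mu.-integrable setT (EFin \o (fun t => r * u t)).
  by move=> intu; apply: eq_integrable (integrableZl _ r intu).
apply: complex_eqP; rewrite ?cReM ?cImM /=.
  under eq_Rintegral do rewrite cReM.
  by rewrite RintegralB ?RintegralZl//; exact: Z.
under eq_Rintegral do rewrite cImM.
by rewrite RintegralD ?RintegralZl//; exact: Z.
Qed.

Lemma ae_eq_cintT f g : cmeasurable f -> cmeasurable g ->
  {ae mu, forall t, f t = g t} -> cintT f = cintT g.
Proof.
move=> [fr fi] [gr gi] fg; apply: complex_eqP => /=; rewrite /Rintegral;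
  congr fine.
  apply: ae_eq_integral => //; [exact/measurable_EFinP|exact/measurable_EFinP|].
  by refine (ae_imp fg _) => t -> _.
apply: ae_eq_integral => //; [exact/measurable_EFinP|exact/measurable_EFinP|].
by refine (ae_imp fg _) => t -> _.
Qed.

Lemma cintT_fubini F : cintegrable2 F ->
  cintT (fun t => cintT (F t)) = cintT (fun s => cintT (F^~ s)).
Proof.
move=> [Fr Fi]; apply: complex_eqP => /=.
  exact: (Rfubini (G := fun z => Re (F z.1 z.2)) Fr).
exact: (Rfubini (G := fun z => Im (F z.1 z.2)) Fi).
Qed.

Lemma cmeasurable_fubini F : cintegrable2 F ->
  cmeasurable (fun t => cintT (F t)).
Proof.
move=> [Fr Fi]; split => /=.
  exact: (Rintegral_fubini_measurable (G := fun z => Re (F z.1 z.2)) Fr).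
exact: (Rintegral_fubini_measurable (G := fun z => Im (F z.1 z.2)) Fi).
Qed.

Lemma ae_cintegrable F : cintegrable2 F ->
  {ae mu, forall t, cintegrable setT (F t)}.
Proof.
by move=> [Fr Fi]; refine (ae_imp2 (ae_integrable1 Fr) (ae_integrable1 Fi) _).
Qed.

Lemma cintegrable2_shear f g : cintegrable setT f -> cintegrable setT g ->
  cintegrable2 (fun t s => f (t + s) * g s).
Proof.
move=> [fr fi] [gr gi]; split.
  apply: eq_integrable (integrableB _ (integrable_mul_shear fr gr)
    (integrable_mul_shear fi gi)) => //= z _.
  by rewrite cReM.
apply: eq_integrable (integrableD _ (integrable_mul_shear fr gi)
  (integrable_mul_shear fi gr)) => //= z _.
by rewrite cImM.
Qed.

Lemma cintegrable2_bounded (k : R) e F : cmeasurable e ->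
  (forall t, cmod (e t) <= k) ->
  cintegrable2 F -> cintegrable2 (fun t s => e t * F t s).
Proof.
move=> [er ei] ek [Fr Fi].
have rk t : `|Re (e t)| <= k := le_trans (normr_Re_le _) (ek t).
have ik t : `|Im (e t)| <= k := le_trans (normr_Im_le _) (ek t).
split.
  apply: eq_integrable (integrableB _
    (integrable_bounded_mul (G := fun z => Re (F z.1 z.2)) er rk Fr)
    (integrable_bounded_mul (G := fun z => Im (F z.1 z.2)) ei ik Fi)) =>
      //= z _.
  by rewrite cReM.
apply: eq_integrable (integrableD _
  (integrable_bounded_mul (G := fun z => Im (F z.1 z.2)) er rk Fi)
  (integrable_bounded_mul (G := fun z => Re (F z.1 z.2)) ei ik Fr)) => //= z _.
by rewrite cImM.
Qed.

Lemma cac_cintegrable a b e : cac a b e -> cintegrable `[a, b] e.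
Proof.
move=> ce; apply: cintegrable_eq (cac_cintegrableM ce (_ : cintegrable _ (fun=>
  1))).
  by move=> t _; rewrite mulr1.
have muy : (mu `[a, b]%classic < +oo)%E.
  by rewrite lebesgue_measure_itv/=; case: ifP => //; rewrite -EFinB ltry.
by split; apply: measurable_bounded_integrable => //; exact: bounded_cst.
Qed.

Lemma cac_bounded a b e : cac a b e ->
  exists2 k, 0 <= k & forall t, a <= t <= b -> cmod (e t) <= k.
Proof.
move=> [er ei].
have [k k0 rk] := within_continuous_bounded (ac_continuous er).
have [l l0 il] := within_continuous_bounded (ac_continuous ei).
exists (k + l); first by rewrite addr_ge0 ?ltW.
by move=> t tab; apply: (le_trans (cmod_le_parts _)); rewrite lerD ?rk ?il.
Qed.

(** After extending e, f and g by zero outside [0, x], the product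
    e t * (f (t + s) * g s) is supported in the triangle 0 <= t, 0 <= s,
    t + s <= x, and both sides are its iterated integrals, with r = t + s on the
    right.  The factor e t can be moved under the inner integral for almost
    every t, namely when s |-> f (t + s) * g s is integrable. *)
Lemma cint_shear x e f g : cac 0 x e -> cintegrable `[0, x] f ->
  cintegrable `[0, x] g ->
  cint 0 x (fun t => e t * cint 0 (x - t) (fun s => f (t + s) * g s)) =
  cint 0 x (fun s => cint s x (fun r => e (r - s) * (f r * g s))).
Proof.
move=> ce intf intg.
pose ext (h : R -> R[i]) t := if 0 <= t <= x then h t else 0.
pose H t s := ext f (t + s) * ext g s.
have [k k0 ek] := cac_bounded ce.
have me : cmeasurable (ext e).
  exact/cintegrable_cmeasurable/cintegrable_mkcond/cac_cintegrable.
have ek' t : cmod (ext e t) <= k.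
  rewrite /ext; case: ifP => [/ek//|_].
  by rewrite ComplexField.Normc.normc0.
have intH : cintegrable2 H.
  by apply: cintegrable2_shear; exact: cintegrable_mkcond.
have intF := cintegrable2_bounded me ek' intH.
have cintT0 : cintT (fun=> 0) = 0.
  by apply: complex_eqP => /=; rewrite Rintegral_cst// mul0r.
transitivity (cintT (fun t => ext e t * cintT (H t))).
  rewrite cint_cintT; apply: eq_cintT => t; rewrite /ext; case: ifP => [|_];
    last by rewrite mul0r.
  move=> /andP[t0 tx]; congr (_ * _); rewrite cint_cintT; apply: eq_cintT => s.
  rewrite /H /ext; case: ifPn => [/andP[s0 sx]|].
    by rewrite !ifT//; apply/andP; split; lra.
  rewrite negb_and -!ltNge => /orP[s0|sx].
    by rewrite [X in _ * X]ifF ?mulr0//; apply/negbTE;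
      rewrite negb_and -ltNge s0.
  rewrite ifF ?mul0r//; apply/negbTE; rewrite negb_and -!ltNge; apply/orP;
    right; lra.
rewrite (@ae_eq_cintT _ (fun t => cintT (fun s => ext e t * H t s)));
  last 3 first.
- by apply: cmeasurableM => //; exact: cmeasurable_fubini.
- exact: cmeasurable_fubini.
- by refine (ae_imp (ae_cintegrable intH) _) => t Ht; rewrite cintTZ.
rewrite (cintT_fubini intF) [RHS]cint_cintT; apply: eq_cintT => s;
  case: ifPn => [|sx]; last first.
  rewrite -[RHS]cintT0; apply: eq_cintT => t.
  by rewrite /H [ext g s]/ext (negbTE sx) !mulr0.
move=> /andP[s0 sx].
have mh : cmeasurable (fun r : R => ext e (r - s) * (ext f r * g s)).
  apply: cmeasurableM; first exact: cmeasurable_shift.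
  apply: cmeasurableM; first exact/cintegrable_cmeasurable/cintegrable_mkcond.
  by split; exact: measurable_cst.
rewrite [RHS]cint_cintT.
transitivity (cintT (fun r => ext e (r - s) * (ext f r * g s))).
  rewrite -[RHS](cintT_shift s mh); apply: eq_cintT => t.
  by rewrite addrK /H [ext g s]/ext s0 sx.
apply: eq_cintT => r; case: ifPn => [/andP[sr rx]|].
  by rewrite /ext !ifT//; apply/andP; split; lra.
rewrite negb_and -!ltNge => /orP[sr|rx]; rewrite /ext.
  rewrite ifF ?mul0r//; apply/negbTE; rewrite negb_and -!ltNge; apply/orP;
    left; lra.
rewrite [X in _ * (X * _)]ifF ?mul0r ?mulr0//; apply/negbTE.
by rewrite negb_and -!ltNge rx orbT.
Qed.

End ComplexFubini.

(** * The columns of the Dirac system *)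
Section DiracColumn.
Local Open Scope complex_scope.
Variable R : realType.
Local Notation mu := (@lebesgue_measure R).
Implicit Types (s y : R -> R[i]) (k z c : R[i]).

Lemma cintegrable_norm_parts s : cintegrable `[0, 1] s ->
  mu.-integrable `[0, 1] (EFin \o (fun t => `|Re (s t)| + `|Im (s t)|)).
Proof.
move=> [sr si].
by apply: eq_integrable (integrableD _ (integrable_norm sr)
  (integrable_norm si)).
Qed.

Lemma cintegrable_cexpM c s : cintegrable `[0, 1] s ->
  cintegrable `[0, 1] (fun t => cexp (c * t%:C) * s t).
Proof. by apply: cac_cintegrableM; exact: cac_cexp. Qed.

(** The set in the definition of [sup_osc] is bounded, by a multiple of the
    norm of the integrand on [0, 1]; otherwise its [sup] would be 0. *)
Lemma sup_osc_ub s c x : cintegrable `[0, 1] s -> 0 <= x <= 1 ->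
  cmod (cint 0 x (fun t => cexp (c * t%:C) * s t)) <= sup_osc s c.
Proof.
move=> ints x01; have inth := cintegrable_cexpM c ints.
pose h t := cexp (c * t%:C) * s t.
apply: ub_le_sup; last by exists x => //=; rewrite in_itv.
exists (2 * \int[mu]_(t in `[0, 1]) (`|Re (h t)| + `|Im (h t)|)).
move=> _ [y /= + <-]; rewrite in_itv/= => /andP[y0 y1].
have intN := cintegrable_norm_parts inth.
apply: (le_trans (cmod_cint_le (g := fun t =>
  `|Re (h t)| + `|Im (h t)|) _ _ _)).
- exact: cintegrable_sub inth.
- exact: integrable_on_sub intN.
- by move=> t _; exact: cmod_le_parts.
- rewrite ler_wpM2l// (Rintegral_itv_chasles y0 y1)// lerDl.
  by apply: Rintegral_ge0 => t _; rewrite addr_ge0.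
Qed.

Lemma sup_osc_ge0 s c : cintegrable `[0, 1] s -> 0 <= sup_osc s c.
Proof.
move=> ints; apply: (le_trans (cmod_ge0 _) (sup_osc_ub c (x := 0) ints _)).
by rewrite lexx ler01.
Qed.

Lemma cmod_cexp_le (d : R) z (t : R) : `|Re z| <= d -> 0 <= t <= 1 ->
  cmod (cexp (z * t%:C)) <= expR d.
Proof.
move=> zd /andP[t0 t1]; rewrite cmod_cexp Re_mulrC ler_expR.
apply: (le_trans (ler_norm _)); rewrite normrM (ger0_norm t0).
by apply: le_trans zd; rewrite ler_piMr.
Qed.

(** Variation of constants: a = e^(- k t) y1 and b = e^(k t) y2 satisfy the
    hypotheses of [remainder_quadratic], and multiplying its conclusion by
    e^(k x) and e^(- k x) gives back y1 and y2. *)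
Lemma dirac_column s1 s2 (d : R) : cintegrable `[0, 1] s1 ->
  cintegrable `[0, 1] s2 ->
  exists2 c : R, 0 <= c & forall k y1 y2 (g : R), `|Re k| <= d ->
    cac 0 1 y1 -> cac 0 1 y2 -> y1 0 = 1 -> y2 0 = 0 ->
    {ae mu, forall x, 0 <= x <= 1 ->
      is_cderive x y1 (k * y1 x - s1 x * y2 x) /\
      is_cderive x y2 (- k * y2 x - s2 x * y1 x)} ->
    (forall x, 0 <= x <= 1 ->
      cmod (cint 0 x (fun t => cexp (2 * k * t%:C) * s2 t)) <= g) ->
    forall x, 0 <= x <= 1 ->
      cmod (y1 x - cexp (x%:C * k) - cint 0 x (fun t =>
        cexp ((x - 2 * t)%:C * k) *
         cint 0 (x - t) (fun xi => s1 (t + xi) * s2 xi))) <= c * g ^+ 2 /\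
      cmod (y2 x - cint 0 x (fun t => cexp (- ((x - 2 * t)%:C * k)) * - s2 t))
         <= c * g ^+ 2.
Proof.
move=> int1 int2.
pose h t := expR (2 * d) *
  ((`|Re (s1 t)| + `|Im (s1 t)|) + (`|Re (s2 t)| + `|Im (s2 t)|)).
have h0 t : 0 <= h t by rewrite mulr_ge0 ?expR_ge0// !addr_ge0.
have inth : mu.-integrable `[0, 1] (EFin \o h).
  by apply: eq_integrable (integrableZl _ (expR (2 * d)) (integrableD _
    (cintegrable_norm_parts int1) (cintegrable_norm_parts int2))).
have [c c0 cP] := remainder_quadratic h0 inth.
exists (expR d * c); first by rewrite mulr_ge0 ?expR_ge0.
move=> k y1 y2 g kd cy1 cy2 y10 y20 dy kg.
pose p t := cexp (- (2 * k) * t%:C) * s1 t.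
pose q t := cexp (2 * k * t%:C) * s2 t.
have intp : cintegrable `[0, 1] p by exact: cintegrable_cexpM.
have intq : cintegrable `[0, 1] q by exact: cintegrable_cexpM.
have k2d : `|Re (2 * k)| <= 2 * d.
  by rewrite mulr_natl mulr2n cReD (le_trans
    (ler_normD _ _))// mulr_natl mulr2n lerD.
have ph t : 0 <= t <= 1 -> cmod (p t) <= h t.
  move=> t01; rewrite cmodM; apply: ler_pM; rewrite ?cmod_ge0//.
    by apply: cmod_cexp_le => //; rewrite cReN normrN.
  by rewrite (le_trans (cmod_le_parts _))// lerDl addr_ge0.
have qh t : 0 <= t <= 1 -> cmod (q t) <= h t.
  move=> t01; rewrite cmodM; apply: ler_pM; rewrite ?cmod_ge0//.
    exact: cmod_cexp_le.
  by rewrite (le_trans (cmod_le_parts _))// lerDr addr_ge0.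
pose a t := cexp (- k * t%:C) * y1 t.
pose b t := cexp (k * t%:C) * y2 t.
have cca : cac 0 1 a by apply: cacM => //; exact: cac_cexp.
have ccb : cac 0 1 b by apply: cacM => //; exact: cac_cexp.
have a0 : a 0 = 1 by rewrite /a y10 mulr1 mulr0 cexp0.
have b0 : b 0 = 0 by rewrite /b y20 mulr0.
have dab : {ae mu, forall x, 0 <= x <= 1 ->
    is_cderive x a (- (p x * b x)) /\ is_cderive x b (- (q x * a x))}.
  refine (ae_imp dy _) => t dt t01; have [d1 d2] := dt t01.
  split.
    apply: is_cderive_eq (is_cderiveM (is_cderive_cexp (- k) t) d1) _.
    have -> : p t = cexp (- k * t%:C) * cexp (- k * t%:C) * s1 t.
      by rewrite /p -cexpD; congr (cexp _ * _); ring.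
    have := cexpNK (k * t%:C); rewrite -mulNr => E.
    rewrite /b; transitivity (- (cexp (- k * t%:C) * (cexp (- k * t%:C) * cexp
      (k * t%:C)) * s1 t * y2 t)); last by ring.
    by rewrite E; ring.
  apply: is_cderive_eq (is_cderiveM (is_cderive_cexp k t) d2) _.
  have -> : q t = cexp (k * t%:C) * cexp (k * t%:C) * s2 t.
    by rewrite /q -cexpD; congr (cexp _ * _); ring.
  have := cexpNK (k * t%:C); rewrite -mulNr => E.
  rewrite /a; transitivity (- (cexp (k * t%:C) * (cexp (- k * t%:C) * cexp
    (k * t%:C)) * s2 t * y1 t)); last by ring.
  by rewrite E; ring.
move=> x /[dup] x01 /andP[x0 x1].
have [le1 le2] := cP p q a b g intp intq ph qh cca ccb a0 b0 dab kg x x01.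
have kE : cexp (k * x%:C) * cexp (- k * x%:C) = 1.
  by rewrite mulNr mulrC cexpNK.
have y1E : y1 x = cexp (k * x%:C) * a x by rewrite /a mulrA kE mul1r.
have y2E : y2 x = cexp
  (- k * x%:C) * b x by rewrite /b mulrA [X in X * _]mulrC kE mul1r.
have intp' := cintegrable_sub (lexx 0) x1 intp.
have intq' := cintegrable_sub (lexx 0) x1 intq.
split; last first.
  have -> : cint 0 x (fun t => cexp (- ((x - 2 * t)%:C * k)) * - s2 t) =
      - cexp (- k * x%:C) * cint 0 x q.
    rewrite -cintZ//; apply: cint_eq => t _.
    rewrite /q mulrA mulNr -cexpD mulrN mulNr; congr (- (cexp _ * _)).
    by rewrite rmorphB rmorphM rmorph_nat; ring.
  rewrite y2E [- cexp _ * _]mulNr opprK -mulrDr cmodM -mulrA; apply: ler_pM;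
    rewrite ?cmod_ge0//.
  by apply: cmod_cexp_le => //; rewrite cReN normrN.
rewrite (cint_shear (e := fun t => cexp ((x - 2 * t)%:C * k))); last 3 first.
- have -> : (fun t => cexp ((x - 2 * t)%:C * k)) =
      (fun t => cexp (k * x%:C) * cexp (- (2 * k) * t%:C)).
    apply/funext => t; rewrite -cexpD; congr cexp.
    by rewrite rmorphB rmorphM rmorph_nat; ring.
  by apply: cacM; [exact: cac_cst|exact: cac_cexp].
- exact: cintegrable_sub int1.
- exact: cintegrable_sub int2.
have -> : cint 0 x (fun s : R => cint s x (fun r : R =>
  cexp ((x - 2 * (r - s))%:C * k) * (s1 r * s2 s))) =
    cexp (k * x%:C) * cint 0 x (fun t => (cint 0 x p - cint 0 t p) * q t).
  rewrite -cintZ; last first.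
    apply: cac_cintegrableM => //; apply: cacB; first exact: cac_cst.
    exact: cac_primitive.
  apply: cint_eq => s /andP[s0 sx].
  transitivity (cint s x (fun r => cexp (k * x%:C) * q s * p r)).
    apply: cint_eq => r _; rewrite /p /q.
    transitivity (cexp (k * x%:C) * cexp (2 * k * s%:C) * cexp (-
      (2 * k) * r%:C) * (s1 r * s2 s)); last by ring.
    rewrite -!cexpD; congr (cexp _ * _).
    by rewrite rmorphB rmorphM rmorphB rmorph_nat; ring.
  rewrite cintZ; last exact: cintegrable_sub intp'.
  rewrite (cint_chasles s0 sx intp'); ring.
rewrite [x%:C * k]mulrC y1E -[X in _ - X - _]mulr1 -!mulrBr cmodM -mulrA.
by apply: ler_pM; rewrite ?cmod_ge0//; exact: cmod_cexp_le.
Qed.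

End DiracColumn.

(** * From the columns to the matrix *)
Section DiracMatrix.
Variable R : realType.
Implicit Types (s : R -> R[i]).

Lemma dirac_kernel_mx22 s1 s2 (x t : R) : dirac_kernel s1 s2 x t =
  mx22 (cint 0 (x - t) (fun xi => s1 (t + xi) * s2 xi)) (- s1 t)
       (- s2 t) (cint 0 (x - t) (fun xi => s2 (t + xi) * s1 xi)).
Proof.
have cint0 a b : cint a b (fun=> 0) = 0 :> R[i].
  by apply: complex_eqP => /=; rewrite Rintegral_cst// mul0r.
have JJ xi i j : (Jmx s1 s2 (t + xi) *m Jmx s1 s2 xi) i j =
    mx22 (s1 (t + xi) * s2 xi) 0 0 (s2 (t + xi) * s1 xi) i j.
  by rewrite mx22M !mul0r !mulr0 !addr0 !add0r.
apply/matrixP => i j; rewrite !mxE.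
rewrite (_ : (fun xi => _) = (fun xi =>
  mx22 (s1 (t + xi) * s2 xi) 0 0 (s2 (t + xi) * s1 xi) i j)); last first.
  by apply/funext => xi; exact: JJ.
have [i0|i0] := boolP (i == 0); have [j0|j0] := boolP (j == 0).
- rewrite oppr0 add0r; apply: cint_eq => xi _; by rewrite !mxE i0 j0.
- rewrite (_ : cint _ _ _ = 0) ?addr0// -[RHS](cint0 0 (x - t)).
  by apply: cint_eq => xi _; rewrite !mxE i0 (negbTE j0).
- rewrite (_ : cint _ _ _ = 0) ?addr0// -[RHS](cint0 0 (x - t)).
  by apply: cint_eq => xi _; rewrite !mxE j0 (negbTE i0).
- rewrite oppr0 add0r; apply: cint_eq => xi _;
  by rewrite !mxE (negbTE i0) (negbTE j0).
Qed.

Lemma mxnorm1_le (M : 'M[R[i]]_2) (k : R) : (forall i j, cmod (M i j) <= k) ->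
  mxnorm1 M <= 4 * k.
Proof.
move=> Mk; apply: (@le_trans _ _ (\sum_(i < 2) \sum_(j < 2) k)).
  by apply: ler_sum => i _; apply: ler_sum => j _.
by rewrite !sumr_const !card_ord -mulrnA mulr_natl.
Qed.

Lemma mulmx2E (A B : 'M[R[i]]_2) i j :
  (A *m B) i j = A i 0 * B 0 j + A i 1 * B 1 j.
Proof.
rewrite mxE big_ord_recl big_ord1.
by congr (_ * _ + A i _ * B _ _); exact: val_inj.
Qed.

Lemma ord2P (i : 'I_2) : i = 0 \/ i = 1.
Proof. by case: i => [[|[|//]] ?]; [left|right]; exact: val_inj. Qed.

End DiracMatrix.

Theorem mainTheorem4 (R : realType) (s1 s2 : R -> R[i])
    (hs1 : cintegrable `[0, 1] s1) (hs2 : cintegrable `[0, 1] s2)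
    (d : R) (hd : 0 < d) :
  exists c2 : R, forall (mu : R[i]) (D : R -> 'M[R[i]]_2),
    strip d mu -> is_solution s1 s2 mu D ->
    forall (x : R) (R0 : 'M[R[i]]_2), 0 <= x <= 1 ->
      D x = mxexp (x%:C%C *: Amx mu) +
            mxint 0 x (fun t => mxexp ((x - 2 * t)%:C%C *: Amx mu) *m
                                dirac_kernel s1 s2 x t) + R0 ->
      mxnorm1 R0 <= c2 * Gamma s1 s2 mu ^+ 2.
Proof.
have [c c0 cP] := dirac_column d hs1 hs2.
have [c' c'0 c'P] := dirac_column d hs2 hs1.
exists (4 * (c + c')) => mu D mud [acD dD D0] x R0 x01 xE.
pose k := 'i%C * mu.
have kd : `|Re k| <= d by rewrite /k cReM /= mul0r mul1r sub0r normrN.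
have kd' : `|Re (- k)| <= d by rewrite cReN normrN.
pose G := Gamma s1 s2 mu.
have s1_ge0 z : 0 <= sup_osc s1 z by exact: sup_osc_ge0.
have s2_ge0 z : 0 <= sup_osc s2 z by exact: sup_osc_ge0.
have G1 y : 0 <= y <= 1 ->
  cmod (cint 0 y (fun t => cexp (2 * - k * t%:C%C) * s1 t)) <= G.
  move=> y01; rewrite mulrN /k mulrA; apply: (le_trans (sup_osc_ub _ hs1 y01)).
  by rewrite /G /Gamma -addrA lerDl !addr_ge0.
have G2 y : 0 <= y <= 1 ->
  cmod (cint 0 y (fun t => cexp (2 * k * t%:C%C) * s2 t)) <= G.
  move=> y01; rewrite /k mulrA; apply: (le_trans (sup_osc_ub _ hs2 y01)).
  by rewrite /G /Gamma addrA lerDr !addr_ge0.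
have cacD i j : cac 0 1 (fun x => D x i j) by exact: abs_continuous_cac.
have dD' : {ae @lebesgue_measure R, forall x, 0 <= x <= 1 -> forall j,
    is_cderive x (fun x => D x 0 j) (k * D x 0 j - s1 x * D x 1 j) /\
    is_cderive x (fun x => D x 1 j) (- k * D x 1 j - s2 x * D x 0 j)}.
  refine (ae_imp dD _) => y + y01 j => /(_ y01)[D' dD' DE].
  have DE' i : D' i j = (Amx mu *m D y) i j - (Jmx s1 s2 y *m D y) i j.
    by rewrite -DE mxE addrK.
  split; (apply: is_cderive_eq; first exact: dD');
    rewrite DE' !mulmx2E !mxE /= /k; ring.
have col0 := cP k (fun x => D x 0 0) (fun x =>
  D x 1 0) G kd (cacD 0 0) (cacD 1 0).
have [|||le00 le10] := col0 _ _ _ G2 x x01.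
- by rewrite D0 mxE.
- by rewrite D0 mxE.
- by refine (ae_imp dD' _) => y dy y01; exact: dy y01 0.
(* In reverse order, the components of the second column solve the system of
   the first one with s1 and s2 exchanged and k negated. *)
have col1 := c'P (- k) (fun x => D x 1 1) (fun x =>
  D x 0 1) G kd' (cacD 1 1) (cacD 0 1).
have [|||le11 le01] := col1 _ _ _ G1 x x01.
- by rewrite D0 mxE.
- by rewrite D0 mxE.
- refine (ae_imp dD' _) => y dy y01; rewrite opprK.
  by have [? ?] := dy y01 1.
pose e (t : R) := cexp ((x - 2 * t)%:C%C * k).
pose e' (t : R) := cexp (- ((x - 2 * t)%:C%C * k)).
have expE (t : R) : mxexp (t%:C%C *: Amx mu) =
    mx22 (cexp (t%:C%C * k)) 0 0 (cexp (- (t%:C%C * k))).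
  by rewrite /Amx scalerA mxexp_J0.
have R0E i j : R0 i j =
    D x i j - mx22 (cexp (x%:C%C * k)) 0 0 (cexp (- (x%:C%C * k))) i j -
    cint 0 x (fun t => mx22
      (e t * cint 0 (x - t) (fun xi => s1 (t + xi) * s2 xi)) (e t * - s1 t)
      (e' t * - s2 t)
      (e' t * cint 0 (x - t) (fun xi => s2 (t + xi) * s1 xi)) i j).
  have entry (A B C : 'M[R[i]]_2) :
    (A - B - C) i j = A i j - B i j - C i j by rewrite !mxE.
  have -> : R0 = D x - mxexp (x%:C%C *: Amx mu) -
      mxint 0 x (fun t =>
        mxexp ((x - 2 * t)%:C%C *: Amx mu) *m dirac_kernel s1 s2 x t).
    move: xE; move: (mxexp _) (mxint _ _ _) => E M ->.
    by rewrite [E + M + R0 - E]addrAC [E + M]addrC addrK addrAC subrr add0r.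
  rewrite entry expE; congr (_ - _); rewrite [LHS]mxE; apply: cint_eq => t _.
  by rewrite expE dirac_kernel_mx22 mx22M !mul0r !addr0 !add0r.
have cG : c * G ^+ 2 <= (c + c') * G ^+ 2.
  by rewrite ler_wpM2r ?exprn_ge0 ?lerDl// !addr_ge0.
have cG' : c' * G ^+ 2 <= (c + c') * G ^+ 2.
  by rewrite ler_wpM2r ?exprn_ge0 ?lerDr// !addr_ge0.
rewrite -mulrA; apply: mxnorm1_le => i j; rewrite R0E.
have [->|->] := ord2P i; have [->|->] := ord2P j.
- apply: le_trans cG; apply: le_trans le00; rewrite [mx22 _ _ _ _ _ _]mxE /=.
  by rewrite (cint_eq (g := fun t => e t * cint 0 (x - t) (fun xi =>
    s1 (t + xi) * s2 xi))) // => t _; rewrite mxE.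
- apply: le_trans cG'; apply: le_trans le01;
  rewrite [mx22 _ _ _ _ _ _]mxE /= subr0.
  rewrite (cint_eq (g := fun t =>
    cexp (- ((x - 2 * t)%:C%C * - k)) * - s1 t)) // => t _.
  by rewrite mxE /= [_ * - k]mulrN opprK.
- apply: le_trans cG; apply: le_trans le10;
  rewrite [mx22 _ _ _ _ _ _]mxE /= subr0.
  by rewrite (cint_eq (g := fun t => e' t * - s2 t)) // => t _; rewrite mxE.
- apply: le_trans cG'; apply: le_trans le11;
  rewrite [mx22 _ _ _ _ _ _]mxE /= mulrN.
  rewrite (cint_eq (g := fun t =>
    cexp ((x - 2 * t)%:C%C * - k) * cint 0 (x - t) (fun xi =>
    s2 (t + xi) * s1 xi))) // => t _.
  by rewrite mxE /= [_ * - k]mulrN.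
Qed.
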